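(* Let $(M,g)$ be a compact connected Riemannian manifold with (nonempty) smooth boundary $\partial M$, and let $p>1$. Then $$\frac{(p-1)^{p-1}}{2p^p}\,\Gamma_p^S(M)\;\le\;\sigma_{1,p}(M)\;\le\;2^{p-1}\,\Gamma_p^S(M),$$ where $\sigma_{1,p}(M)$ is the first nontrivial variational Steklov eigenvalue of the $p$-Laplacian on $M$ and $\Gamma_p^S(M)$ is the Steklov $p$-isocapacitary constant.
   Context: Let $n=\dim M$; $\mathrm{d}V$ is the Riemannian volume measure on $M$ and $\mathrm{d}S$ is the $(n-1)$-dimensional Hausdorff measure on $\partial M$ induced by $g$. $C^\infty(M)$ denotes real-valued functions smooth on $M$ (up to the boundary). For measurable $U\subset\partial M$, $\mathrm{Area}(U)=\int_U 1\,\mathrm{d}S$. Capacity: for disjoint nonempty compact sets $A,B\subset M$, $$\mathrm{Cap}_p(A,B,M)=\inf\left\{\int_M|\nabla u|^p\,\mathrm{d}V:\ u\in C^\infty(M),\ u\ge 1\text{ on }A,\ u\le 0\text{ on }B\right\}.$$ By convention $\mathrm{Cap}_p(A,B,M)=+\infty$ if $A\cap B\neq\varnothing$, and $\mathrm{Cap}_p(A,B,M)=0$ if $A=\varnothing$ or $B=\varnothing$. Steklov $p$-isocapacitary constant: $$\Gamma_p^S(M)=\inf_{A,B\subset\partial M}\frac{\mathrm{Cap}_p(A,B,M)}{\min\{\mathrm{Area}(A),\mathrm{Area}(B)\}},$$ the infimum being over all compact subsets $A,B$ of $\partial M$ for which $\min\{\mathrm{Area}(A),\mathrm{Area}(B)\}>0$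 (so that the quotient is meaningful). Steklov problem for the $p$-Laplacian: $\Delta_p u=0$ in $M$, $|\nabla u|^{p-2}\frac{\partial u}{\partial\nu}=\sigma|u|^{p-2}u$ on $\partial M$ ($\nu$ the outward unit normal), understood weakly: $(u,\sigma)\in W^{1,p}(M)\times\mathbb{R}$ is a solution iff $\int_M\langle|\nabla u|^{p-2}\nabla u,\nabla\varphi\rangle\,\mathrm{d}V=\sigma\int_{\partial M}|u|^{p-2}u\varphi\,\mathrm{d}S$ for all $\varphi\in W^{1,p}(M)$. Its first nontrivial variational eigenvalue $\sigma_{1,p}(M)$ is given by the Rayleigh quotient characterization $$\sigma_{1,p}(M)=\inf\left\{\frac{\int_M|\nabla u|^p\,\mathrm{d}V}{\int_{\partial M}|u|^p\,\mathrm{d}S}:\ u\in C^\infty(M),\ \int_{\partial M}|u|^{p-2}u\,\mathrm{d}S=0,\ u\not\equiv0\right\},$$ where the quotient is read as $+\infty$ when its denominator is $0$. *)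

(* Defs.v *)
From HB Require Import structures.
From mathcomp Require Import all_boot all_order all_algebra.
From mathcomp Require Import all_classical all_reals all_analysis.

Set Implicit Arguments.
Unset Strict Implicit.
Unset Printing Implicit Defensive.

Import Order.TTheory GRing.Theory Num.Theory.
Import numFieldNormedType.Exports.

Local Open Scope classical_set_scope.
Local Open Scope ring_scope.

Section smoothness.
Context {R : realType} {V : normedModType R}.
Implicit Types (D U : set V) (f : V -> R).

Definition iter_derive (vs : seq V) f : V -> R :=
  foldr (fun v h x => 'D_v h x) f vs.

Definition smooth_on U f : Prop :=
  forall (vs : seq V) x, U x -> differentiable (iter_derive vs f) x.

(* Smoothness on a set that need not be open (a relatively open subset of a
   half-space, a closed interval): local existence of smooth extensions. *)
Definition smooth_within D f : Prop :=
  forall x, D x -> exists U (F : V -> R),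
    [/\ open U, U x, smooth_on U F & forall y, U y -> D y -> F y = f y].

(* Directional derivative using only increments that stay in D; at a boundary
   point of D it is the one-sided derivative. *)
Definition derive_within D f (x v : V) : R :=
  lim ((fun h : R => h^-1 * (f (h *: v + x) - f x))
         @ within [set h : R | D (h *: v + x)] 0^').

End smoothness.

Definition half_space {R : realType} {n : nat} : set 'rV[R]_n.+1 :=
  [set x | 0 <= x ord0 ord0].

(* Smooth structure with boundary, of dimension n.+1.  The map [icoord i] is
   relevant only on the image of the chart [coord i]. *)
Record smooth_atlas (R : realType) (n : nat) (M : topologicalType) :=
  SmoothAtlas {
  index : Type;
  dom : index -> set M;
  coord : index -> M -> 'rV[R]_n.+1;
  icoord : index -> 'rV[R]_n.+1 -> M;
  chart_at : M -> index;
  dom_open : forall i, open (dom i);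
  dom_chart_at : forall q, dom (chart_at q) q;
  icoordK : forall i q, dom i q -> icoord i (coord i q) = q;
  coord_image : forall i, exists2 W : set 'rV[R]_n.+1,
    open W & coord i @` dom i = W `&` half_space;
  coord_continuous : forall i, {within dom i, continuous (coord i)};
  icoord_continuous : forall i,
    {within coord i @` dom i, continuous (icoord i)};
  transition_smooth : forall i j k,
    smooth_within (coord i @` (dom i `&` dom j))
      (fun x => coord j (icoord i x) ord0 k) }.

Section manifold.
Context {R : realType} {n : nat} {M : topologicalType}.
Variable X : smooth_atlas R n M.

Definition chart_image (i : index X) : set 'rV[R]_n.+1 := coord i @` dom i.

Definition boundary : set M :=
  [set q | exists2 i : index X, dom i q & coord i q ord0 ord0 = 0].

Definition smooth_function (u : M -> R) : Prop :=
  forall i : index X, smooth_within (chart_image i) (u \o icoord i).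

Definition transition_jacobian (i j : index X) (x : 'rV[R]_n.+1) :
    'M[R]_n.+1 :=
  \matrix_(k, l) derive_within (coord i @` (dom i `&` dom j))
    (fun y => coord j (icoord i y) ord0 l) x (delta_mx ord0 k).

(* [metric i x] is the matrix of g in the chart i at the point of coordinates
   x; tangent vectors are row vectors, which a change of charts multiplies on
   the right by the Jacobian matrix. *)
Record riemannian_metric := RiemannianMetric {
  metric : index X -> 'rV[R]_n.+1 -> 'M[R]_n.+1;
  metric_sym : forall i x, chart_image i x -> (metric i x)^T = metric i x;
  metric_pos : forall i x, chart_image i x ->
    forall v : 'rV[R]_n.+1, v != 0 ->
    0 < (v *m metric i x *m v^T) ord0 ord0;
  metric_smooth : forall i k l,
    smooth_within (chart_image i) (fun x => metric i x k l);
  metric_transition : forall i j x, (coord i @` (dom i `&` dom j)) x ->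
    metric i x = transition_jacobian i j x
      *m metric j (coord j (icoord i x)) *m (transition_jacobian i j x)^T }.

Variable g : riemannian_metric.

Definition tangent_norm (i : index X) (x v : 'rV[R]_n.+1) : R :=
  Num.sqrt ((v *m metric g i x *m v^T) ord0 ord0).

Definition gradient (i : index X) (u : M -> R) (x : 'rV[R]_n.+1) :
    'rV[R]_n.+1 :=
  (\row_k derive_within (chart_image i) (u \o icoord i) x (delta_mx ord0 k))
    *m invmx (metric g i x).

Definition gradient_norm (u : M -> R) (q : M) : R :=
  let i := chart_at X q in
  tangent_norm i (coord i q) (gradient i u (coord i q)).

Definition smooth_curve (c : R -> M) : Prop :=
  {within `[0, 1], continuous c} /\
  forall (i : index X) k,
    smooth_within (`[0, 1] `&` c @^-1` dom i) (fun t => coord i (c t) ord0 k).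

Definition curve_speed (c : R -> M) (t : R) : R :=
  let i := chart_at X (c t) in
  tangent_norm i (coord i (c t))
    (\row_k derive_within (`[0, 1] `&` c @^-1` dom i)
       (fun s => coord i (c s) ord0 k) t 1).

Definition curve_length (c : R -> M) : \bar R :=
  (\int[lebesgue_measure]_(t in `[0%R, 1%R]) (curve_speed c t)%:E)%E.

(* [joined q r l]: some piecewise smooth curve from q to r, given as a chain of
   smooth curves parametrized by [0, 1], has length l. *)
Inductive joined : M -> M -> \bar R -> Prop :=
| joined_nil q : joined q q 0%E
| joined_cons c r l : smooth_curve c -> joined (c 1) r l ->
    joined (c 0) r (curve_length c + l)%E.

Definition riemannian_distance (q r : M) : \bar R :=
  ereal_inf [set l | joined q r l].

End manifold.

(* Volume of the unit ball of R^k. *)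
Fixpoint unit_ball_volume (R : realType) (k : nat) : R :=
  match k with
  | 0 => 1
  | 1 => 2
  | k'.+2 => 2 * pi / k%:R * unit_ball_volume R k'
  end.

Section hausdorff.
Context {R : realType} {T : Type}.
Variables (d : T -> T -> \bar R) (k : nat).
Local Open Scope ereal_scope.

Definition diameter (C : set T) : \bar R :=
  ereal_sup [set d x y | x in C & y in C].

(* The empty set has weight 0 also when k = 0, so that the 0-dimensional
   Hausdorff measure is the counting measure. *)
Definition hausdorff_weight (C : set T) : \bar R :=
  if C == set0 then 0
  else (unit_ball_volume R k * (fine (diameter C) / 2) ^+ k)%R%:E.

Definition hausdorff_premeasure (delta : R) (A : set T) : \bar R :=
  ereal_inf [set \sum_(j <oo) hausdorff_weight (C j) | C in
    [set C : nat -> set T |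
      A `<=` \bigcup_j C j /\ forall j, diameter (C j) <= delta%:E]].

Definition hausdorff_measure (A : set T) : \bar R :=
  ereal_sup [set hausdorff_premeasure delta A | delta in
    [set delta : R | (0 < delta)%R]].

End hausdorff.

(* Integral over R^k, for nonnegative Borel functions, with respect to the
   k-fold product of the Lebesgue measure. *)
Fixpoint lebesgue_integral_rV (R : realType) (k : nat) :
    ('rV[R]_k -> \bar R) -> \bar R :=
  match k with
  | 0 => fun f => f 0
  | k'.+1 => fun f => (\int[lebesgue_measure]_(t in [set: R])
      lebesgue_integral_rV (fun v : 'rV[R]_k' =>
        f (row_mx (t%:M : 'M[R]_1) v)))%E
  end.

Notation borel M := (g_sigma_algebraType (@open M)).

Section steklov.
Context {R : realType} {n : nat} {M : ptopologicalType}.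
Variables (X : smooth_atlas R n M) (g : riemannian_metric X).
Local Open Scope ereal_scope.

(* dV = sqrt (det g) dx in every chart.  As countably many charts cover a
   compact M, this determines the measure. *)
Definition is_volume_measure (V : {measure set (borel M) -> \bar R}) : Prop :=
  forall (i : index X) (B : set (borel M)), measurable B -> B `<=` dom i ->
  V B = lebesgue_integral_rV (fun x : 'rV[R]_n.+1 =>
          (\1_(coord i @` B) x * Num.sqrt (\det (metric g i x)))%:E).

(* The n-dimensional Hausdorff measure of the boundary of the
   (n.+1)-dimensional manifold M, extended by 0 to the Borel sets of M. *)
Definition is_boundary_measure (S : {measure set (borel M) -> \bar R}) : Prop :=
  forall B : set (borel M), measurable B ->
  S B = hausdorff_measure (riemannian_distance g) n (B `&` boundary X).

Variables V S : {measure set (borel M) -> \bar R}.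
Variable p : R.

Definition area (U : set M) : \bar R := \int[S]_(x in U) 1.

Definition energy (u : M -> R) : \bar R :=
  \int[V]_(x in [set: M]) (gradient_norm g u x `^ p)%R%:E.

Definition capacity (A B : set M) : \bar R :=
  if A `&` B != set0 then +oo
  else if (A == set0) || (B == set0) then 0
  else ereal_inf [set energy u | u in
    [set u : M -> R | [/\ smooth_function X u,
       (forall x, A x -> (1 <= u x)%R) & (forall x, B x -> (u x <= 0)%R)]]].

Definition steklov_isocapacitary_constant : \bar R :=
  ereal_inf [set capacity AB.1 AB.2 / mine (area AB.1) (area AB.2) | AB in
    [set AB : set M * set M |
      [/\ compact AB.1 /\ AB.1 `<=` boundary X,
          compact AB.2 /\ AB.2 `<=` boundary X
        & 0 < mine (area AB.1) (area AB.2)]]].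

Definition steklov_quotient (u : M -> R) : \bar R :=
  let b := \int[S]_(x in boundary X) (`|u x| `^ p)%R%:E in
  if b == 0 then +oo else energy u / b.

Definition steklov_eigenvalue : \bar R :=
  ereal_inf [set steklov_quotient u | u in
    [set u : M -> R | [/\ smooth_function X u,
       \int[S]_(x in boundary X) (`|u x| `^ (p - 2) * u x)%R%:E = 0
     & exists x, u x != 0%R]]].

End steklov.

(* Main.v *)
(** The upper bound: if [u >= 1] on [A] and [u <= 0] on [B], subtract from [u]
    the constant [c] for which [u - c] is admissible for the eigenvalue; the
    energy is unchanged, and the boundary integral of [|u - c|^p] is bounded below
    because [|u - c| >= 1 - c] on [A] if [c <= 1] and [|u - c| >= c] on [B] if
    [c >= 0], while [2^(1 - p) <= (1 - c)^p + c^p] for [0 <= c <= 1].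

    The lower bound: by convexity the constraint makes [c = 0] minimize the
    boundary integral of [|u - c|^p], so [c] may be taken to be a median of [u]
    on the boundary.  With [w = u - c] or [w = c - u], the capacity of
    [{w >= t}, {w <= 0}] is at most the energy of [F (w / t)], where [F] is a
    smooth approximation of the truncation of [r^(p / (p - 1))] to [0, 1].
    Summed over a geometric sequence of levels [t] with ratio close to [1], these
    energies form a geometric series, whose sum is the constant
    [p^p / (p - 1)^(p - 1)] up to a factor close to [1], while the measures of the
    superlevel sets sum up to the boundary integral of [w_+^p].  Neither the
    coarea formula nor Fubini's theorem is needed, and the measurability of
    [|grad u|] is not either, because the integral of nonnegative functions,
    a supremum over simple functions, is superadditive on all functions.

    Geometry enters only through two facts: the boundary is closed (a point
    cannot be interior in one chart and on the boundary in another) and its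
    Hausdorff measure is finite (the Riemannian distance is bounded by a multiple
    of the Euclidean one in a chart). *)
From Pilot Require Import Defs.
From HB Require Import structures.
From mathcomp Require Import all_boot all_order all_algebra.
From mathcomp Require Import all_classical all_reals all_analysis.
From mathcomp Require Import measurable_realfun ring lra.
(* MathComp shadows [index], [coord] and [coord_continuous] of Defs. *)
Import Pilot.Defs.

Set Implicit Arguments.
Unset Strict Implicit.
Unset Printing Implicit Defensive.

Import Order.TTheory GRing.Theory Num.Theory.
Import numFieldNormedType.Exports.

Local Open Scope classical_set_scope.
Local Open Scope ring_scope.

(** * Smooth functions *)

Section smooth_calculus.
Context {R : realType} {V : normedModType R}.
Implicit Types (U D : set V) (f g : V -> R).

Lemma near_eq_differentiable f g (x : V) :
  (\near x, f x = g x) -> differentiable f x -> differentiable g x.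
Proof.
move=> fg df; have fgx : f x = g x := nbhs_singleton fg.
have gE : g \o shift x = cst (g x) + 'd f x +o_ 0 id.
  apply/eqaddoP => e e0.
  have /eqaddoP /(_ e e0) := diff_locally df.
  have fg' : \forall h \near (0 : V), f (h + x) = g (h + x).
    by move: fg; rewrite (near_shift 0) subr0.
  apply: filter_app; near=> h.
  rewrite -![(_ - _ : _ -> _) _]/(_ - _) -![(_ + _ : _ -> _) _]/(_ + _) /=.
  by rewrite /cst fgx (near fg' h).
apply/diff_locallyP.
have dE : 'd g x = 'd f x :> (V -> R).
  exact: diff_unique (diff_continuous df) gE.
by rewrite dE; split=> //; exact: diff_continuous.
Unshelve. all: by end_near. Qed.

(** Smoothness cut off at order [N]: the product and chain rules go by induction on [N], since a
    derivative of a product is a sum of products to which the induction hypothesis applies again. *)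
Definition smooth_upto (N : nat) U f : Prop :=
  forall (vs : seq V) x, (size vs <= N)%N -> U x ->
    differentiable (iter_derive vs f) x.

(** The last vector of the list is differentiated first, so [rcons] isolates the innermost
    derivative and lets [smooth_uptoS] replace [f] by its first derivatives. *)
Lemma iter_derive_rcons vs v f :
  iter_derive (rcons vs v) f = iter_derive vs (fun x => 'D_v f x).
Proof. by rewrite /iter_derive foldr_rcons. Qed.

Lemma eq_iter_derive U f g vs : open U -> (forall x, U x -> f x = g x) ->
  forall x, U x -> iter_derive vs f x = iter_derive vs g x.
Proof.
move=> oU fg; elim: vs => [|v vs IH] x Ux //=; first exact: fg.
apply: near_eq_derive; near=> y; apply: IH; near: y.
exact: open_nbhs_nbhs.
Unshelve. all: by end_near. Qed.

Lemma smooth_upto0 U f :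
  smooth_upto 0 U f <-> forall x, U x -> differentiable f x.
Proof.
split=> [h x Ux|h [|//] x _ Ux]; last exact: h.
exact: (h [::]).
Qed.

Lemma smooth_uptoS N U f : smooth_upto N.+1 U f <->
  (forall x, U x -> differentiable f x) /\
  forall v, smooth_upto N U (fun x => 'D_v f x).
Proof.
split=> [h|[h0 h]].
  split=> [x Ux|v vs x sN Ux]; first exact: (h [::]).
  by rewrite -iter_derive_rcons; apply: h => //; rewrite size_rcons.
move=> vs x; case/lastP: vs => [|vs v] sN Ux; first exact: h0.
by rewrite iter_derive_rcons; apply: h => //; rewrite size_rcons in sN.
Qed.

Lemma smooth_onE U f : smooth_on U f <-> forall N, smooth_upto N U f.
Proof.
by split=> [h N vs x _ Ux|h vs x Ux]; [exact: h|exact: (h (size vs))].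
Qed.

Lemma smooth_upto_diff N U f x : smooth_upto N U f -> U x -> differentiable f x.
Proof. by move=> h Ux; exact: (h [::]). Qed.

Lemma smooth_uptoW N U f : smooth_upto N.+1 U f -> smooth_upto N U f.
Proof. by move=> h vs x sN Ux; apply: h => //; exact: leqW. Qed.

Lemma eq_smooth_upto N U f g : open U -> (forall x, U x -> f x = g x) ->
  smooth_upto N U f -> smooth_upto N U g.
Proof.
move=> oU fg h vs x sN Ux; apply: near_eq_differentiable (h vs x sN Ux).
near=> y; apply: eq_iter_derive fg _ _ => //; near: y.
exact: open_nbhs_nbhs.
Unshelve. all: by end_near. Qed.

Lemma smooth_upto_cst N U (c : R) : smooth_upto N U (cst c).
Proof.
elim: N c => [|N IH] c; first by apply/smooth_upto0 => x _.
apply/smooth_uptoS; split=> [x _|v]; first exact: differentiable_cst.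
have -> : (fun x : V => 'D_v (cst c) x) = cst 0.
  by apply/funext => x; rewrite derive_cst.
exact: IH.
Qed.

Lemma smooth_uptoD N U f g : open U ->
  smooth_upto N U f -> smooth_upto N U g -> smooth_upto N U (f + g).
Proof.
move=> oU; elim: N f g => [|N IH] f g.
  move=> /smooth_upto0 hf /smooth_upto0 hg; apply/smooth_upto0 => x Ux.
  by apply: differentiableD; [exact: hf|exact: hg].
move=> /smooth_uptoS[hf hf'] /smooth_uptoS[hg hg']; apply/smooth_uptoS; split.
  by move=> x Ux; apply: differentiableD; [exact: hf|exact: hg].
move=> v; apply: (@eq_smooth_upto _ _ ((fun x => 'D_v f x) + (fun x => 'D_v g x))) => //.
  by move=> x Ux; rewrite deriveD//; apply: diff_derivable; [exact: hf|exact: hg].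
exact: IH.
Qed.

Lemma smooth_uptoM N U f g : open U ->
  smooth_upto N U f -> smooth_upto N U g -> smooth_upto N U (f * g).
Proof.
move=> oU; elim: N f g => [|N IH] f g.
  move=> /smooth_upto0 hf /smooth_upto0 hg; apply/smooth_upto0 => x Ux.
  by apply: differentiableM; [exact: hf|exact: hg].
move=> Hf Hg; move: (Hf) (Hg).
move=> /smooth_uptoS[hf hf'] /smooth_uptoS[hg hg']; apply/smooth_uptoS; split.
  by move=> x Ux; apply: differentiableM; [exact: hf|exact: hg].
move=> v; apply: (@eq_smooth_upto _ _
    (f * (fun x => 'D_v g x) + g * (fun x => 'D_v f x))) => //.
  move=> x Ux; rewrite deriveM//; apply: diff_derivable; [exact: hf|exact: hg].
by apply: smooth_uptoD => //; apply: IH => //; exact: smooth_uptoW.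
Qed.

Lemma derive_comp1 (phi : R -> R) f x v (d : R) : differentiable f x ->
  is_derive (f x) 1 phi d ->
  differentiable (phi \o f) x /\ 'D_v (phi \o f) x = d * 'D_v f x.
Proof.
move=> df [/derivable1_diffP dphi dE].
have dc : differentiable (phi \o f) x by exact: differentiable_comp.
split=> //; rewrite !deriveE// diff_comp//= -dE deriveE//.
by rewrite -[X in 'd phi _ X]mulr1 [LHS]linearZ mulrC.
Qed.

(* A family of functions that is closed under differentiation consists of
   smooth functions; by the chain rule the same holds after composition. *)
Lemma smooth_on_comp (P : (R -> R) -> Prop) :
  (forall phi, P phi -> exists2 phi', P phi' &
     forall r : R, is_derive r 1 phi (phi' r)) ->
  forall phi U f, P phi -> open U -> smooth_on U f -> smooth_on U (phi \o f).
Proof.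
move=> dP phi U f Pphi oU /smooth_onE sf; apply/smooth_onE => N.
elim: N phi Pphi => [|N IH] phi Pphi; have [phi' Pphi' dphi] := dP _ Pphi.
  apply/smooth_upto0 => x Ux.
  by have [] := derive_comp1 0 (smooth_upto_diff (sf 0%N) Ux) (dphi (f x)).
apply/smooth_uptoS; split=> [x Ux|v].
  by have [] := derive_comp1 0 (smooth_upto_diff (sf 0%N) Ux) (dphi (f x)).
apply: (@eq_smooth_upto _ _ ((phi' \o f) * (fun x => 'D_v f x))) => //.
  move=> x Ux.
  by have [_ ->] := derive_comp1 v (smooth_upto_diff (sf 0%N) Ux) (dphi (f x)).
apply: smooth_uptoM => //; first exact: IH.
by have /smooth_uptoS[] := sf N.+1.
Qed.

Lemma smooth_onD U f g : open U ->
  smooth_on U f -> smooth_on U g -> smooth_on U (f + g).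
Proof.
move=> oU /smooth_onE sf /smooth_onE sg; apply/smooth_onE => N.
exact: smooth_uptoD.
Qed.

Lemma smooth_on_cst U (c : R) : smooth_on U (cst c).
Proof. by apply/smooth_onE => N; exact: smooth_upto_cst. Qed.

Lemma smooth_onM U f g : open U ->
  smooth_on U f -> smooth_on U g -> smooth_on U (f * g).
Proof.
move=> oU /smooth_onE sf /smooth_onE sg; apply/smooth_onE => N.
exact: smooth_uptoM.
Qed.

End smooth_calculus.

(** * A smooth truncation of a power function *)

Section smooth_step.
Context {R : realType}.
Implicit Types (a b e r : R).

(** The classical flat function [expR (- (e / r))], damping a power of real, possibly negative,
    exponent [b]. Its derivative combines the functions of exponents [b - 1] and [b - 2], so
    smoothness reduces to a closure property. *)
Definition exp_cut e b r : R := if 0 < r then r `^ b * expR (- (e / r)) else 0.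

Lemma exp_cut_le0 e b r : r <= 0 -> exp_cut e b r = 0.
Proof. by move=> r0; rewrite /exp_cut ltNge r0. Qed.

Lemma exp_cut_ge0 e b r : 0 <= exp_cut e b r.
Proof.
by rewrite /exp_cut; case: ifP => // _; rewrite mulr_ge0 ?powR_ge0 ?expR_ge0.
Qed.

(** Raising [y <= expR y], with [y = e / r / m], to the power [m] bounds the exponential factor by a
    multiple of [r ^+ m]; the choice of [m] gives [b + m >= 2], which suffices as [r < 1]. *)
Lemma exp_cut_le_sqr e b : 0 < e ->
  exists C : R, forall r, `|r| < 1 -> `|exp_cut e b r| <= C * `|r| ^+ 2.
Proof.
move=> e0; pose m := (Num.bound `|2 - b|).+1.
exists ((m%:R / e) ^+ m) => r r1.
have m0 : 0 < m%:R :> R by rewrite ltr0n.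
rewrite /exp_cut; case: ifPn => r0; last first.
  by rewrite normr0 mulr_ge0// exprn_ge0// divr_ge0// ltW.
have rn0 : r != 0 by rewrite gt_eqF.
have {}r1 : r < 1 by rewrite gtr0_norm in r1.
rewrite ger0_norm ?mulr_ge0 ?powR_ge0 ?expR_ge0// gtr0_norm//.
have E1 : expR (- (e / r)) <= (m%:R / e) ^+ m * r ^+ m.
  have -> : - (e / r) = m%:R * - (e / r / m%:R).
    by field; rewrite rn0 gt_eqF.
  rewrite expRM_natl -exprMn; apply: lerXn2r.
  - by rewrite nnegrE expR_ge0.
  - by rewrite nnegrE mulr_ge0 ?divr_ge0// ltW.
  have -> : m%:R / e * r = (e / r / m%:R)^-1.
    by field; rewrite rn0 !gt_eqF.
  have y0 : 0 < e / r / m%:R by rewrite !divr_gt0.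
  rewrite expRN lef_pV2 ?posrE ?expR_gt0//.
  by apply: le_trans (expR_ge1Dx _); rewrite lerDr.
apply: (@le_trans _ _ (r `^ b * ((m%:R / e) ^+ m * r ^+ m))).
  by rewrite ler_wpM2l ?powR_ge0.
rewrite mulrCA ler_wpM2l ?exprn_ge0 ?divr_ge0 ?(ltW m0) ?(ltW e0)//.
rewrite -!powR_mulrn ?(ltW r0)// -powRD; last by rewrite rn0 implybT.
apply: ger_powR; first by rewrite r0 ltW.
rewrite -lerBlDl; apply: (le_trans (ler_norm _)).
apply: ltW; apply: lt_le_trans (archi_boundP (normr_ge0 _)) _.
by rewrite /m ler_nat.
Qed.

Lemma is_derive_exp_cut e b r : 0 < e ->
  is_derive r 1 (exp_cut e b)
    (b * exp_cut e (b - 1) r + e * exp_cut e (b - 2) r).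
Proof.
move=> e0; have [r0|r0|->] := ltgtP r 0.
- rewrite !exp_cut_le0 ?(ltW r0)// !mulr0 addr0.
  apply: (@near_eq_is_derive _ _ _ (cst 0)).
  near=> z; rewrite exp_cut_le0//; apply: ltW; near: z; exact: lt_nbhsl.
- have rn0 : r != 0 by rewrite gt_eqF.
  apply: (@near_eq_is_derive _ _ _
    ((fun z => z `^ b) * (expR \o (fun z => - e * z^-1)))).
    near=> z; have z0 : 0 < z by near: z; exact: lt_nbhsr.
    by rewrite /exp_cut z0 /= -mulNr.
  have d1 := is_derive1_powR b r0.
  have d2 : is_derive r 1 (fun z : R => - e * z^-1) (e / r ^+ 2).
    have dV := is_deriveZ (- e) (is_deriveV rn0 (is_derive_id r (1 : R))).
    by apply: is_derive_eq dV _; rewrite scalerA mulrNN [LHS]mulr1.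
  have d3 := is_derive1_comp (is_derive_expR _) d2.
  apply: is_derive_eq (is_deriveM d1 d3) _.
  rewrite /exp_cut r0 /= mulNr.
  have p1 : r `^ b = r * r `^ (b - 1).
    by rewrite -{2}(powRr1 (ltW r0)) -powRD ?rn0 ?implybT// addrC subrK.
  have p2 : r `^ b = r ^+ 2 * r `^ (b - 2).
    by rewrite -(powR_mulrn 2 (ltW r0)) -powRD ?rn0 ?implybT// addrC subrK.
  rewrite /GRing.scale /= [in LHS]p2; field; exact: rn0.
(* At the origin the difference quotient is at most [C * |h|] in absolute value, so the derivative
   is 0. *)
have [C HC] := exp_cut_le_sqr b e0.
rewrite !exp_cut_le0// !mulr0 addr0.
have H : (fun h : R => h^-1 *: ((exp_cut e b \o shift 0) (h *: 1) - exp_cut e b 0))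
    @ 0^' --> (0 : R).
  apply/cvgr0Pnorm_lt => d d0.
  have C0 : 0 <= C.
    have := HC (2^-1); rewrite gtr0_norm ?invr_gt0// invf_lt1// ltr1n => /(_ isT) h.
    by move: (le_trans (normr_ge0 _) h); rewrite pmulr_lge0// exprn_gt0 ?invr_gt0.
  near=> h.
  have hn0 : h != 0 by near: h; exact: nbhs_dnbhs_neq.
  have h1 : `|h| < 1.
    near: h; apply: dnbhs0_lt; exact: ltr01.
  have h2 : `|h| < d / (C + 1).
    near: h; apply: dnbhs0_lt; by rewrite divr_gt0// ltr_wpDl.
  rewrite [exp_cut e b 0]exp_cut_le0// subr0 /= addr0 [h%:A]mulr1.
  rewrite normrZ normfV ltr_pdivrMl ?normr_gt0//.
  apply: le_lt_trans (HC _ h1) _.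
  rewrite mulrC expr2 -mulrA ltr_pM2l ?normr_gt0//.
  rewrite -(@ltr_pM2r _ (C + 1)) ?ltr_wpDl// in h2.
  rewrite divfK in h2; last by rewrite gt_eqF// ltr_wpDl.
  apply: le_lt_trans h2; rewrite ler_wpM2l// lerDl//.
by split; [apply/cvg_ex; exists 0|exact/cvg_lim].
Unshelve. all: by end_near. Qed.

(** The linear span of the functions [exp_cut e b] with [e] fixed: closed under differentiation, as
    [smooth_on_comp] requires. *)
Inductive exp_cut_span e : (R -> R) -> Prop :=
| exp_cut_span1 b : exp_cut_span e (exp_cut e b)
| exp_cut_spanZ (c : R) f : exp_cut_span e f -> exp_cut_span e (c *: f)
| exp_cut_spanD f g :
    exp_cut_span e f -> exp_cut_span e g -> exp_cut_span e (f + g).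

Lemma exp_cut_span_derive e phi : 0 < e -> exp_cut_span e phi ->
  exists2 phi', exp_cut_span e phi' & forall r, is_derive r 1 phi (phi' r).
Proof.
move=> e0; elim=> [b|c f _ [f' Pf' df]|f g _ [f' Pf' df] _ [g' Pg' dg]].
- exists (b *: exp_cut e (b - 1) + e *: exp_cut e (b - 2)).
    apply: exp_cut_spanD; apply: exp_cut_spanZ; exact: exp_cut_span1.
  by move=> r; exact: is_derive_exp_cut.
- exists (c *: f'); first exact: exp_cut_spanZ.
  by move=> r; exact: is_deriveZ.
- exists (f' + g'); first exact: exp_cut_spanD.
  by move=> r; exact: is_deriveD.
Qed.

Lemma smooth_on_exp_cut e b (V : normedModType R) (U : set V) (f : V -> R) :
  0 < e -> open U -> smooth_on U f -> smooth_on U (exp_cut e b \o f).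
Proof.
move=> e0; apply: (@smooth_on_comp _ _ (exp_cut_span e)).
  by move=> phi; exact: exp_cut_span_derive.
exact: exp_cut_span1.
Qed.

Lemma le_expR_onem (z : R) : 0 <= z -> (1 + z) * expR (- z) <= 1.
Proof.
by move=> z0; rewrite expRN ler_pdivrMr ?expR_gt0// mul1r expR_ge1Dx.
Qed.

(** The derivative is that of the undamped power times [(1 + z / b) * expR (- z)] with [z = e / r],
    and this factor is at most [(1 + z) * expR (- z) <= 1]: damping does not make the power
    steeper. *)
Lemma exp_cut_derive_bound e b r : 0 < e -> 1 <= b -> 0 < r ->
  0 <= b * exp_cut e (b - 1) r + e * exp_cut e (b - 2) r <= b * r `^ (b - 1).
Proof.
move=> e0 b1 r0; have b0 : 0 <= b by rewrite (le_trans _ b1).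
rewrite addr_ge0 ?mulr_ge0 ?exp_cut_ge0 ?(ltW e0)//=.
have rn0 : r != 0 by rewrite gt_eqF.
rewrite /exp_cut r0.
have -> : r `^ (b - 1) = r * r `^ (b - 2).
  rewrite -{2}(powRr1 (ltW r0)) -powRD ?rn0 ?implybT//.
  by congr (_ `^ _); ring.
have -> : b * (r * r `^ (b - 2) * expR (- (e / r))) +
    e * (r `^ (b - 2) * expR (- (e / r))) =
    r * r `^ (b - 2) * ((b + e / r) * expR (- (e / r))) by field.
rewrite [leRHS]mulrC ler_wpM2l ?mulr_ge0 ?powR_ge0 ?(ltW r0)//.
have er : 0 <= e / r by rewrite divr_ge0 ?ltW.
apply: (@le_trans _ _ (b * ((1 + e / r) * expR (- (e / r))))).
  rewrite mulrA ler_wpM2r ?expR_ge0// mulrDr mulr1 lerD2l.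
  by rewrite ler_peMl.
by rewrite ler_piMr// le_expR_onem.
Qed.

(** What the capacity estimate asks of a cutoff. The bound on [F'] is, up to the constant, the slope
    of the power of exponent [b] truncated to [[0, 1]]. *)
Definition smooth_step_spec (K : R) b (F F' : R -> R) : Prop :=
  [/\ forall (V : normedModType R) (U : set V) (f : V -> R),
        open U -> smooth_on U f -> smooth_on U (F \o f),
      forall r, is_derive r 1 F (F' r),
      forall r, r <= 0 -> F r = 0,
      forall r, 1 <= r -> F r = 1 &
      forall r, `|F' r| <= if 0 < r < 1 then K * r `^ (b - 1) else 0].

(* [exp_cut e 1] has slope at most 1 and vanishes on the negative half-line, so
   that [y |-> 1 - exp_cut e 1 (1 - y)] flattens the graph above [y = 1], and
   [r |-> expR e * exp_cut e b r] is an approximation of [r |-> r `^ b]. *)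
Lemma smooth_stepP e b : 0 < e -> 1 < b ->
  exists F F', smooth_step_spec (expR (2 * e) * b) b F F'.
Proof.
move=> e0 b1.
pose G (r : R) : R := 1 - expR e * exp_cut e b r.
pose dk b r := b * exp_cut e (b - 1) r + e * exp_cut e (b - 2) r.
pose F (r : R) : R := 1 - expR e * exp_cut e 1 (G r).
pose F' r := expR e * dk 1 (G r) * (expR e * dk b r).
have dG r : is_derive r 1 G (- (expR e * dk b r)).
  have dk0 := is_derive_exp_cut b r e0.
  have -> : G = cst 1 - expR e *: exp_cut e b by [].
  have dG := is_deriveB (is_derive_cst (1 : R) r (1 : R)) (is_deriveZ (expR e) dk0).
  by apply: is_derive_eq dG _; rewrite sub0r.
(* For [r >= 1] both the power of [r] and [expR (e - e / r)] are at least 1. *)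
have G0 r : 1 <= r -> G r <= 0.
  move=> r1; have r0 : 0 < r by rewrite (lt_le_trans _ r1).
  rewrite subr_le0 /exp_cut r0 mulrCA -expRD -[leLHS]mul1r ler_pM//.
    by rewrite -[leLHS](powRr0 r) ler_powR// (le_trans _ (ltW b1)).
  rewrite -[leLHS]expR0 ler_expR subr_ge0 ler_pdivrMr//.
  by rewrite ler_peMr// ltW.
exists F, F'; split.
- move=> V U f oU sf.
  have E (phi : R -> R) (h : V -> R) :
      smooth_on U (phi \o h) -> smooth_on U ((fun y => 1 - expR e * phi y : R) \o h).
    move=> sh; have := smooth_onD oU (@smooth_on_cst _ _ U 1)
      (smooth_onM oU (@smooth_on_cst _ _ U (- expR e)) sh).
    congr (smooth_on _ _); apply/funext => x.
    by rewrite /= -[LHS]/(1 + - expR e * phi (h x)) mulNr.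
  apply: (E (fun r => exp_cut e 1 (G r))).
  apply: (@smooth_on_exp_cut e 1 _ _ (G \o f)) => //; apply: E.
  exact: smooth_on_exp_cut.
- move=> r.
  have dk1 := is_derive_exp_cut 1 (G r) e0.
  have d1 := is_derive1_comp dk1 (dG r).
  have -> : F = cst 1 - expR e *: (exp_cut e 1 \o G) by [].
  have dF := is_deriveB (is_derive_cst (1 : R) r (1 : R)) (is_deriveZ (expR e) d1).
  apply: is_derive_eq dF _.
  by rewrite /F' /dk /GRing.scale /=; ring.
- move=> r r0; rewrite /F /G [exp_cut e b r]exp_cut_le0// mulr0 subr0.
  by rewrite /exp_cut ltr01 divr1 powR1 mul1r -expRD subrr expR0 subrr.
- by move=> r r1; rewrite /F [X in _ * X]exp_cut_le0 ?mulr0 ?subr0// G0.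
move=> r; rewrite /F' !normrM (gtr0_norm (expR_gt0 e)).
have dk0 b' z : z <= 0 -> dk b' z = 0.
  by move=> z0; rewrite /dk !exp_cut_le0// !mulr0 addr0.
have [r0|r0] := leP r 0; first by rewrite (dk0 b)// normr0 !mulr0.
case: ltP => r1 /=; last first.
  by rewrite (dk0 1) ?normr0 ?mulr0 ?mul0r// G0.
have /andP[p1 p2] := exp_cut_derive_bound e0 (ltW b1) r0.
have dk1 : `|dk 1 (G r)| <= 1.
  have [g0|g0] := leP (G r) 0; first by rewrite dk0// normr0.
  have /andP[q1 q2] := exp_cut_derive_bound e0 (lexx 1) g0.
  by rewrite ger0_norm// (le_trans q2)// subrr powRr0 mulr1.
(* One factor [expR e] comes from the outer layer and one from the inner layer. *)
rewrite (_ : 2 * e = e + e); last by ring.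
rewrite expRD -!mulrA ler_wpM2l ?expR_ge0// mulrCA ler_wpM2l ?expR_ge0//.
by rewrite (ger0_norm p1) -[leRHS]mul1r ler_pM.
Qed.

End smooth_step.

(** * Charts and the boundary *)

Section derive_within_theory.
Context {R : realType} {V : normedModType R}.
Implicit Types (D U : set V) (f F : V -> R).

Lemma near_line (P : set V) x v :
  nbhs x P -> \forall h \near (0 : R), P (h *: v + x).
Proof.
move=> xP; have : \forall w \near (0 : V), P (w + x).
  by have := xP; rewrite -[nbhs x P]/(\forall y \near x, P y) (near_shift 0) subr0.
exact: (@near0Z _ _ v (fun w => P (w + x))).
Qed.

(** Nonzero increments along [v] that stay in [D] exist arbitrarily close to 0. Otherwise the limit
    in [derive_within] would be taken along a degenerate filter. *)
Definition approachable D (x v : V) : Prop :=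
  ProperFilter (within [set h : R | D (h *: v + x)] 0^').

(** The quotients of [f] along increments in [D] are restrictions of those of the extension [F], so
    the one-sided limit is the full derivative of any such extension. *)
Lemma derive_withinE D U f F x v : approachable D x v ->
  open U -> U x -> D x -> (forall y, U y -> D y -> F y = f y) ->
  differentiable F x -> derive_within D f x v = 'D_v F x.
Proof.
move=> PF oU Ux Dx Ff dF; apply: cvg_lim => //.
have dv : derivable F x v by exact: diff_derivable.
have : (fun h : R => h^-1 * (F (h *: v + x) - F x))
    @ within [set h : R | D (h *: v + x)] 0^' --> 'D_v F x.
  apply: cvg_trans dv; apply: cvg_app; exact: cvg_within.
apply: cvg_trans; apply: near_eq_cvg.
rewrite near_withinE.
have UU : \forall h \near 0^', U (h *: v + x).
  by apply: nbhs_dnbhs; apply: near_line; exact: open_nbhs_nbhs.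
near=> h => /= Dh; rewrite !Ff//; exact: (near UU h).
Unshelve. all: by end_near. Qed.

Lemma approachable_dir D x v (s : R) : `|s| = 1 ->
  (\forall h \near (0 : R), 0 < h -> D ((s * h) *: v + x)) ->
  approachable D x v.
Proof.
move=> s1 /nbhs_ballP[d1 /= d10 hd1]; apply: Build_ProperFilter_ex => A.
rewrite /within /dnbhs /within /= => /nbhs_ballP[d2 /= d20 hd2].
pose h := Num.min d1 d2 / 2.
have d0 : 0 < Num.min d1 d2 by rewrite lt_min d10.
have h0 : 0 < h by rewrite divr_gt0.
have hd : h < Num.min d1 d2 by rewrite ltr_pdivrMr// ltr_pMr// ltr1n.
exists (s * h); apply: hd2.
- rewrite /ball /= sub0r normrN normrM s1 mul1r gtr0_norm//.
  by rewrite (lt_le_trans hd)// ge_min lexx orbT.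
- by rewrite mulf_neq0// -normr_gt0 ?s1// gtr0_norm.
- apply: hd1 => //; rewrite /ball /= sub0r normrN gtr0_norm//.
  by rewrite (lt_le_trans hd)// ge_min lexx.
Qed.

End derive_within_theory.

Section half_space_theory.
Context {R : realType} {n : nat}.
Local Notation E := ('rV[R]_n.+1).
Implicit Types (D : set E) (x v : E).

(** At least one of [v] and [- v] does not point out of the half-space; the increments of the
    corresponding sign are used. *)
Lemma approachable_half_space D x v : half_space x ->
  (\forall y \near x, half_space y -> D y) -> approachable D x v.
Proof.
move=> Hx xD.
have dir (s : R) : `|s| = 1 -> 0 <= s * v ord0 ord0 -> approachable D x v.
  move=> s1 sv; apply: (approachable_dir s1).
  have := near_line (s *: v) xD; apply: filterS => h xh h0.
  rewrite mulrC -scalerA; apply: xh; rewrite /half_space /= !mxE.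
  by rewrite addr_ge0// mulr_ge0// ltW.
have [v0|v0] := leP 0 (v ord0 ord0); first by apply: (dir 1); rewrite ?normr1 ?mul1r.
by apply: (dir (-1)); rewrite ?normrN1// mulN1r oppr_ge0 ltW.
Qed.

End half_space_theory.

Section chart_theory.
Context {R : realType} {n : nat} {M : topologicalType}.
Variable X : smooth_atlas R n M.
Local Notation E := ('rV[R]_n.+1).
Implicit Types (i j : index X) (u : M -> R) (q : M).

Lemma chart_image_half i x : chart_image i x -> half_space x.
Proof. by rewrite /chart_image; have [W _ ->] := coord_image i => -[]. Qed.

Lemma near_chart_image i x : chart_image i x ->
  \forall y \near x, half_space y -> chart_image i y.
Proof.
rewrite /chart_image; have [W oW ->] := coord_image i => -[Wx _].
near=> y => Hy; split=> //; near: y; exact: open_nbhs_nbhs.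
Unshelve. all: by end_near. Qed.

Lemma coord_dom_image i q : dom i q -> chart_image i (coord i q).
Proof. by exists q. Qed.

Lemma icoord_dom i x : chart_image i x -> dom i (icoord i x).
Proof. by case=> q qi <-; rewrite icoordK. Qed.

Lemma coordK i x : chart_image i x -> coord i (icoord i x) = x.
Proof. by case=> q qi <-; rewrite icoordK. Qed.

Lemma near_dom i q : dom i q -> \forall r \near q, dom i r.
Proof. by move=> qi; apply: open_nbhs_nbhs; split => //; exact: dom_open. Qed.

Lemma coord_cvg i q : dom i q -> coord i @ q --> coord i q.
Proof.
move=> qi; have /subspace_continuousP/(_ q qi) := @coord_continuous _ _ _ X i.
by rewrite within_interior//; exact: near_dom.
Qed.

Lemma near_icoord i x (P : set M) : chart_image i x -> nbhs (icoord i x) P ->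
  \forall y \near x, half_space y -> P (icoord i y).
Proof.
move=> ix iP.
have /subspace_continuousP/(_ x ix _ iP) := @icoord_continuous _ _ _ X i.
move=> H.
have {}H : \forall y \near x, chart_image i y -> P (icoord i y) := H.
have iN := near_chart_image ix.
near=> y => Hy; apply: (near H y) => //. apply: (near iN y) => //.
Unshelve. all: by end_near. Qed.

Definition overlap i j : set E := coord i @` (dom i `&` dom j).

Lemma overlap_image i j x : overlap i j x -> chart_image i x.
Proof. by move=> [q [qi qj] <-]; exact: coord_dom_image. Qed.

Lemma overlapE i j x : chart_image i x -> dom j (icoord i x) -> overlap i j x.
Proof.
move=> ix jx; exists (icoord i x); last exact: coordK.
by split=> //; exact: icoord_dom.
Qed.

Lemma overlap_dom i j x : overlap i j x -> dom j (icoord i x).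
Proof. by move=> [q [qi qj] <-]; rewrite icoordK. Qed.

Lemma near_overlap i j x : overlap i j x ->
  \forall y \near x, half_space y -> overlap i j y.
Proof.
move=> ox; have ix := overlap_image ox.
have jx := near_icoord ix (near_dom (overlap_dom ox)).
have iN := near_chart_image ix.
near=> y => Hy; apply: overlapE; first by apply: (near iN y).
by apply: (near jx y).
Unshelve. all: by end_near. Qed.

Lemma approachable_overlap i j x v : overlap i j x ->
  approachable (overlap i j) x v.
Proof.
move=> ox; apply: approachable_half_space; last exact: near_overlap.
exact/chart_image_half/overlap_image/ox.
Qed.

Lemma approachable_chart_image i x v : chart_image i x ->
  approachable (chart_image i) x v.
Proof.
move=> ix; apply: approachable_half_space; last exact: near_chart_image.
exact: chart_image_half ix.
Qed.

Lemma smooth_function_continuous u : smooth_function X u -> continuous u.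
Proof.
move=> su q; pose i := chart_at X q.
have qi : dom i q by exact: dom_chart_at.
have [U [F [oU Ux sF Ff]]] := su i _ (coord_dom_image qi).
have uE : \forall r \near q, F (coord i r) = u r.
  have cU : \forall r \near q, U (coord i r).
    by apply: coord_cvg => //; exact: open_nbhs_nbhs.
  near=> r; have ri : dom i r by exact: (near (near_dom qi) r).
  rewrite Ff ?icoordK//=; [by rewrite icoordK|exact: (near cU r)|].
  exact: coord_dom_image.
rewrite /continuous_at -(nbhs_singleton uE).
apply: cvg_trans (near_eq_cvg uE) _.
apply: (@cvg_comp _ _ _ (coord i) F); first exact: coord_cvg.
exact: (differentiable_continuous (sF [::] _ Ux)).
Unshelve. all: by end_near. Qed.

Definition smooth_real (phi : R -> R) : Prop :=
  forall (U : set E) (f : E -> R), open U -> smooth_on U f ->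
  smooth_on U (phi \o f).

Lemma smooth_real_affine (a b : R) : smooth_real (fun y => a * y + b).
Proof.
move=> U f oU sf.
exact: (smooth_onD oU (smooth_onM oU (@smooth_on_cst _ _ U a) sf)
  (@smooth_on_cst _ _ U b)).
Qed.

Lemma smooth_function_comp phi u :
  smooth_real phi -> smooth_function X u -> smooth_function X (phi \o u).
Proof.
move=> sphi su i x ix; have [U [F [oU Ux sF Ff]]] := su i x ix.
exists U, (phi \o F); split=> // [|y Uy iy]; first exact: sphi.
by rewrite /= Ff.
Qed.

(** By the chain rule in a chart the gradient is multiplied by [d], hence the quadratic form by
    [d ^+ 2], and the square root leaves [|d|]. *)
Lemma gradient_norm_comp (g : riemannian_metric X) phi u q (d : R) :
  smooth_function X u -> is_derive (u q) 1 phi d ->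
  gradient_norm g (phi \o u) q = `|d| * gradient_norm g u q.
Proof.
move=> su dphi; rewrite /gradient_norm; set i := chart_at X q.
have qi : dom i q by exact: dom_chart_at.
set x := coord i q; have ix : chart_image i x by exact: coord_dom_image.
have [U [F [oU Ux sF Ff]]] := su i x ix.
have Fx : F x = u q by rewrite Ff//= icoordK.
have dF : differentiable F x by exact: (sF [::]).
have gE : gradient g i (phi \o u) x = d *: gradient g i u x.
  rewrite /gradient scalemxAl; congr (_ *m _); apply/rowP => k; rewrite !mxE.
  have ap := approachable_chart_image (delta_mx ord0 k) ix.
  have dphi' : is_derive (F x) 1 phi d by rewrite Fx.
  have [dpF dpFE] := derive_comp1 (delta_mx ord0 k) dF dphi'.
  rewrite (derive_withinE ap oU Ux ix _ dpF); last first.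
    by move=> y Uy iy; rewrite /= Ff.
  by rewrite (derive_withinE ap oU Ux ix Ff dF).
rewrite gE /tangent_norm -scalemxAl -scalemxAl linearZ /= -scalemxAr.
by rewrite !mxE mulrA -expr2 sqrtrM ?sqr_ge0// sqrtr_sqr.
Qed.

End chart_theory.

Section local_minimum.
Context {R : realType} {V : normedModType R}.

(** A negative derivative in some direction would produce smaller values at small positive
    increments; nonnegativity along both [v] and [- v] leaves 0. *)
Lemma derive_local_min (F : V -> R) x v : differentiable F x ->
  (\forall y \near x, F x <= F y) -> 'D_v F x = 0.
Proof.
move=> dF Fmin.
have ge0 w : 0 <= 'D_w F x.
  rewrite leNgt; apply/negP => neg.
  have dw : derivable F x w by exact: diff_derivable.
  have H1 : \forall h \near 0^', h^-1 * (F (h *: w + x) - F x) < 0.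
    have cw : (fun h : R => h^-1 * (F (h *: w + x) - F x)) @ 0^' --> 'D_w F x.
      exact: dw.
    exact: (cvgr_lt _ cw _ neg).
  have H2 := nbhs_dnbhs (near_line w Fmin).
  have : \forall h \near (0 : R)^', (h : R) <= 0.
    near=> h; rewrite leNgt; apply/negP => h0.
    have : h^-1 * (F (h *: w + x) - F x) < 0 by apply: (near H1 h).
    rewrite pmulr_rlt0 ?invr_gt0// subr_lt0 ltNge.
    by rewrite (near H2 h).
  rewrite /dnbhs /within /= => /nbhs_ballP[d /= d0 hd].
  have : d / 2 <= 0.
    apply: hd; last by rewrite gt_eqF ?divr_gt0.
    rewrite /ball /= sub0r normrN gtr0_norm ?divr_gt0//.
    by rewrite ltr_pdivrMr// ltr_pMr// ltr1n.
  by rewrite leNgt divr_gt0.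
apply/eqP; rewrite eq_le ge0 andbT -oppr_ge0.
by have := ge0 (- v); rewrite !deriveE// linearN.
Unshelve. all: by end_near. Qed.

End local_minimum.

Section row_differentials.
Context {R : realType} {n : nat} {V : normedModType R}.
Local Notation E := ('rV[R]_n.+1).

Lemma differentiable_row (F : 'I_n.+1 -> V -> R) x :
  (forall k, differentiable (F k) x) ->
  differentiable (fun y => (\row_k F k y : E)) x.
Proof.
move=> dF.
have -> : (fun y => (\row_k F k y : E)) =
    \sum_(k < n.+1) (fun y => F k y *: (delta_mx ord0 k : E)).
  apply/funext => y; rewrite [LHS]row_sum_delta fct_sumE.
  by apply: eq_bigr => k _; rewrite mxE.
by apply: differentiable_sum => k; exact: differentiableZl.
Qed.

Lemma diff_row (F : 'I_n.+1 -> V -> R) x v k :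
  (forall k, differentiable (F k) x) ->
  ('d (fun y => (\row_k F k y : E)) x v) ord0 k = 'D_v (F k) x.
Proof.
move=> dF; have dr := differentiable_row dF.
rewrite -deriveE// derive_mx; last exact: diff_derivable.
rewrite mxE.
have -> // : (fun y => (\row_l F l y : E) ord0 k) = F k.
by apply/funext => y; rewrite mxE.
Qed.

Lemma diff_rV_sum (G : E -> R) y w : differentiable G y ->
  'd G y w = \sum_k w ord0 k * 'D_(delta_mx ord0 k) G y.
Proof.
move=> dG; rewrite {1}(row_sum_delta w) linear_sum; apply: eq_bigr => k _.
by rewrite linearZ deriveE.
Qed.

End row_differentials.

(** * Independence of the boundary from the chart *)

Section boundary_theory.
Context {R : realType} {n : nat} {M : topologicalType}.
Variable X : smooth_atlas R n M.
Local Notation E := ('rV[R]_n.+1).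
Implicit Types (i j : index X) (q : M).

Lemma overlap_extension i j x : overlap i j x ->
  exists F : 'I_n.+1 -> E -> R,
    (forall k, differentiable (F k) x) /\
    (\forall y \near x, overlap i j y ->
       forall k, F k y = coord j (icoord i y) ord0 k).
Proof.
move=> ox.
have /choice[F HF] : forall k : 'I_n.+1, exists F : E -> R,
    differentiable F x /\
    \forall y \near x, overlap i j y -> F y = coord j (icoord i y) ord0 k.
  move=> k; have [U [F [oU Ux sF Ff]]] := transition_smooth k ox.
  exists F; split; first exact: (sF [::] _ Ux).
  by near=> y => oy; apply: Ff => //; near: y; exact: open_nbhs_nbhs.
exists F; split=> [k|]; first by have [] := HF k.
have : \forall y \near x, forall k, overlap i j y ->
    F k y = coord j (icoord i y) ord0 k.
  apply: (@filter_forall _ _ (fun k y => overlap i j y ->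
    F k y = coord j (icoord i y) ord0 k) (nbhs x)) => k.
  by have [] := HF k.
by apply: filterS => y H oy k; exact: H.
Unshelve. all: by end_near. Qed.

(* Were a point interior in one chart and on the boundary in another, then the
   first coordinate of the transition map would have a local minimum there, so
   its differential would not be invertible. *)
Lemma boundary_coord i q : dom i q -> boundary X q -> coord i q ord0 ord0 = 0.
Proof.
move=> qi [j qj qj0]; apply/eqP; rewrite eq_le.
have ix := coord_dom_image qi.
have := chart_image_half ix; rewrite /half_space /= => ->; rewrite andbT.
rewrite leNgt; apply/negP => x0.
set x := coord i q in ix x0 *.
have ixq : icoord i x = q by rewrite /x icoordK.
have oij : overlap i j x by apply: overlapE; rewrite ?ixq.
set y0 := coord j q.
have jy0 : icoord j y0 = q by rewrite /y0 icoordK.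
have oji : overlap j i y0.
  by apply: overlapE; [exact: coord_dom_image|rewrite jy0].
have [F [dF FE]] := overlap_extension oij.
have [G [dG GE]] := overlap_extension oji.
(* As the first coordinate of [x] is positive, a full neighbourhood of [x] lies in the half-space,
   hence in the overlap. *)
have nij : \forall y \near x, overlap i j y.
  have nh : \forall y \near x, half_space y.
    have Hc : (fun y : E => y ord0 ord0) @ x --> x ord0 ord0.
      exact: matrix_normedtype.coord_continuous.
    have H : \forall y \near x, 0 < (y : E) ord0 ord0 by exact: (cvgr_gt _ Hc _ x0).
    by apply: filterS H => y; exact: ltW.
  have no := near_overlap oij.
  near=> y; have Hy : half_space y by apply: (near nh y).
  by move: Hy; apply: (near no y).
pose Ft (y : E) : E := \row_k F k y.
have FtE : \forall y \near x, Ft y = coord j (icoord i y).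
  near=> y; apply/rowP => k; rewrite mxE.
  have oy : overlap i j y by apply: (near nij y).
  by move: k; move: oy; apply: (near FE y).
have Ftx : Ft x = y0 by rewrite (nbhs_singleton FtE) ixq.
have dFt : differentiable Ft x by exact: differentiable_row.
(* The extensions of the two transition maps are inverse to each other on a full neighbourhood of
   [x], so the chain rule makes their Jacobian matrices inverse. *)
have GF l : \forall y \near x, G l (Ft y) = y ord0 l.
  have cFt : Ft @ x --> y0 by rewrite -Ftx; exact: differentiable_continuous.
  have GE' := cFt _ GE.
  have {}GE' : \forall y \near x, overlap j i (Ft y) ->
     forall k, G k (Ft y) = coord i (icoord j (Ft y)) ord0 k := GE'.
  near=> y.
  have oy : overlap i j y by apply: (near nij y).
  have FtEy : Ft y = coord j (icoord i y) by apply: (near FtE y).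
  have iy := overlap_image oy; have jy := overlap_dom oy.
  have ojy : overlap j i (Ft y).
    rewrite FtEy; apply: overlapE; first exact: coord_dom_image.
    by rewrite icoordK//; exact: icoord_dom.
  have -> : G l (Ft y) = coord i (icoord j (Ft y)) ord0 l.
    by move: l; move: ojy; apply: (near GE' y).
  by rewrite FtEy icoordK// coordK.
pose A := \matrix_(k < n.+1, l < n.+1) 'D_(delta_mx ord0 k) (F l) x.
pose B := \matrix_(k < n.+1, l < n.+1) 'D_(delta_mx ord0 k) (G l) y0.
have AB : A *m B = 1%:M.
  apply/matrixP => k l; rewrite !mxE.
  have dGl : differentiable (G l) (Ft x) by rewrite Ftx.
  transitivity ('D_(delta_mx ord0 k) (G l \o Ft) x).
    rewrite deriveE; last exact: differentiable_comp.
    rewrite diff_comp//= diff_rV_sum//; apply: eq_bigr => m _.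
    by rewrite diff_row// !mxE Ftx.
  rewrite (@near_eq_derive _ _ _ _ (fun y : E => y ord0 l)); last exact: GF.
  have dl : derivable (id : E -> E) x (delta_mx ord0 k) by [].
  have := derive_mx dl; rewrite derive_id => /matrixP /(_ ord0 l).
  by rewrite !mxE eqxx /= => <-; rewrite eq_sym.
have BA : B *m A = 1%:M by exact: mulmx1C.
(* The first column of [A] vanishes: the first coordinate of the transition map is 0 at [x] and
   nonnegative around it. *)
have : (B *m A) ord0 ord0 = 0.
  rewrite mxE big1// => k _; rewrite [A _ _]mxE derive_local_min ?mulr0//.
  near=> y.
  have oy : overlap i j y by apply: (near nij y).
  have E0 z : Ft z = coord j (icoord i z) -> F ord0 z = coord j (icoord i z) ord0 ord0.
    by move=> <-; rewrite mxE.
  rewrite (E0 x) ?ixq ?Ftx// qj0 E0; last by apply: (near FtE y).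
  apply: (@chart_image_half _ _ _ X j); apply: coord_dom_image.
  exact: overlap_dom oy.
by rewrite BA !mxE eqxx => /eqP; rewrite oner_eq0.
Unshelve. all: by end_near. Qed.

(** Off the boundary the first coordinate in a chart is positive, and stays so nearby; by
    [boundary_coord] a boundary point in the domain of that chart has first coordinate 0. *)
Lemma closed_boundary : closed (boundary X).
Proof.
rewrite -openC openE => q Nq; rewrite /interior.
pose i := chart_at X q; have qi : dom i q by exact: dom_chart_at.
have q0 : 0 < coord i q ord0 ord0.
  rewrite lt_neqAle eq_sym; apply/andP; split.
    by apply/eqP => q0; apply: Nq; exists i.
  exact: (chart_image_half (coord_dom_image qi)).
have Hc : (fun y : E => y ord0 ord0) @ coord i q --> coord i q ord0 ord0.
  exact: matrix_normedtype.coord_continuous.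
have H : \forall y \near coord i q, 0 < (y : E) ord0 ord0 by exact: (cvgr_gt _ Hc _ q0).
have {}H : \forall r \near q, 0 < coord i r ord0 ord0 := coord_cvg qi H.
have di := near_dom qi.
near=> r => br.
have : 0 < coord i r ord0 ord0 by apply: (near H r).
by rewrite boundary_coord ?ltxx//; apply: (near di r).
Unshelve. all: by end_near. Qed.

End boundary_theory.

(** * The integral of nonnegative functions, without measurability *)

Section lower_integral.
Local Open Scope ereal_scope.
Context d (T : measurableType d) (R : realType).
Variable mu : {measure set T -> \bar R}.
Implicit Types (D : set T) (f g : T -> \bar R).

Import HBNNSimple.

Lemma ge0_le_integral_nonmeasurable D f g :
  (forall x, D x -> 0 <= f x) -> (forall x, D x -> f x <= g x) ->
  \int[mu]_(x in D) f x <= \int[mu]_(x in D) g x.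
Proof.
move=> f0 fg; have g0 x : D x -> 0 <= g x.
  by move=> Dx; exact: le_trans (f0 _ Dx) (fg _ Dx).
rewrite !ge0_integralE//; apply: ereal_sup_le => _ [h hf <-].
exists h => // x; apply: le_trans (hf x) _; rewrite /patch.
by case: ifPn => // /set_mem; exact: fg.
Qed.

Lemma ereal_sup_add_le (A B : set (\bar R)) (C : \bar R) :
  A 0 -> B 0 -> (forall a b, A a -> B b -> a + b <= C) ->
  ereal_sup A + ereal_sup B <= C.
Proof.
move=> A0 B0 H; have [->|Cfin] := eqVneq C +oo; first exact: leey.
have C0 : 0 <= C by have := H _ _ A0 B0; rewrite adde0.
have {}Cfin : C \is a fin_num by rewrite ge0_fin_numE// ltey.
have sA0 : 0 <= ereal_sup A by exact: ereal_sup_ubound.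
have sAC : ereal_sup A <= C.
  by apply: ge_ereal_sup => a Aa; have := H _ _ Aa B0; rewrite adde0.
have sAfin : ereal_sup A \is a fin_num.
  by rewrite ge0_fin_numE// (le_lt_trans sAC)// ltey_eq Cfin.
rewrite -leeBrDl//; apply: ge_ereal_sup => b Bb.
rewrite leeBrDl//.
have bC : b <= C by have := H _ _ A0 Bb; rewrite add0e.
case: b Bb bC => [b| |] Bb bC.
- rewrite -leeBrDr//; apply: ge_ereal_sup => a Aa.
  by rewrite leeBrDr//; exact: H.
- by move: Cfin; move: bC; rewrite leye_eq => /eqP ->.
- by rewrite addeNy leNye.
Qed.

(** A simple function below [f] plus one below [g] is a simple function below [f + g]. The reverse
    inequality can fail without measurability. *)
Lemma ge0_integralD_super D f g :
  (forall x, D x -> 0 <= f x) -> (forall x, D x -> 0 <= g x) ->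
  \int[mu]_(x in D) f x + \int[mu]_(x in D) g x <=
  \int[mu]_(x in D) (f x + g x).
Proof.
move=> f0 g0; have fg0 x : D x -> 0 <= f x + g x.
  by move=> Dx; rewrite adde_ge0 ?f0 ?g0.
have P0 (h : T -> \bar R) x : (forall x, D x -> 0 <= h x) -> 0 <= (h \_ D) x.
  by move=> h0; rewrite /patch; case: ifPn => // /set_mem /h0.
rewrite !ge0_integralE//; apply: ereal_sup_add_le.
- by exists nnsfun0; [move=> x; exact: P0|exact: sintegral0].
- by exists nnsfun0; [move=> x; exact: P0|exact: sintegral0].
move=> _ _ [h1 h1f <-] [h2 h2g <-]; rewrite -sintegralD//.
apply: ereal_sup_ubound; exists (add_nnsfun h1 h2) => // x /=.
rewrite EFinD; apply: le_trans (leeD (h1f x) (h2g x)) _.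
by rewrite /patch; case: ifPn => // _; rewrite adde0.
Qed.

Lemma ge0_integral_sum_super D n (f : 'I_n -> T -> \bar R) :
  (forall k x, D x -> 0 <= f k x) ->
  \sum_(k < n) \int[mu]_(x in D) f k x <=
  \int[mu]_(x in D) (\sum_(k < n) f k x).
Proof.
elim: n f => [|n IH] f f0.
  by rewrite big_ord0 integral_ge0// => x _; rewrite big_ord0.
rewrite big_ord_recr /=.
have {}IH := IH (fun k => f (widen_ord (leqnSn n) k)) (fun k => f0 _).
apply: le_trans (leeD2r _ IH) _.
apply: le_trans (ge0_integralD_super _ _) _ => //.
- by move=> x Dx; rewrite sume_ge0// => k _; exact: f0.
- by move=> x Dx; exact: f0.
rewrite le_eqVlt; apply/orP; left; apply/eqP; apply: eq_integral => x _.
by rewrite big_ord_recr.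
Qed.

Lemma ge0_integralZl_super D f (c : R) : (0 <= c)%R ->
  (forall x, D x -> 0 <= f x) ->
  c%:E * \int[mu]_(x in D) f x <= \int[mu]_(x in D) (c%:E * f x).
Proof.
move=> c0 f0; have [cE|cn0] := eqVneq c 0%R.
  by rewrite cE mul0e integral_ge0// => x _; rewrite mul0e.
have {cn0}c0 : (0 < c)%R by rewrite lt_neqAle eq_sym cn0.
have cf0 x : D x -> 0 <= c%:E * f x.
  by move=> Dx; rewrite mule_ge0 ?f0// lee_fin ltW.
rewrite !ge0_integralE// muleC -lee_pdivlMr//.
apply: ge_ereal_sup => _ [h hf <-]; rewrite lee_pdivlMr// muleC -sintegralrM.
apply: ereal_sup_ubound; exists (scale_nnsfun h (ltW c0)) => // x /=.
have := hf x; rewrite /patch; case: ifPn => _ hfx.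
  by rewrite EFinM lee_pmul2l.
by rewrite lee_fin pmulr_rle0// -lee_fin.
Qed.

(** Equality follows by applying [ge0_integralZl_super] to [c] and to its inverse. *)
Lemma ge0_integralZl_nonmeasurable D f (c : R) : (0 <= c)%R ->
  (forall x, D x -> 0 <= f x) ->
  \int[mu]_(x in D) (c%:E * f x) = c%:E * \int[mu]_(x in D) f x.
Proof.
move=> c0 f0; apply/eqP; rewrite eq_le ge0_integralZl_super// andbT.
have [cE|cn0] := eqVneq c 0%R.
  by rewrite cE mul0e integral0_eq// => x _; rewrite mul0e.
have {cn0}c0 : (0 < c)%R by rewrite lt_neqAle eq_sym cn0.
have ci0 : (0 < c^-1)%R by rewrite invr_gt0.
rewrite muleC -lee_pdivrMr// muleC.
apply: le_trans (ge0_integralZl_super (ltW ci0) _) _.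
  by move=> x Dx; rewrite mule_ge0 ?f0// lee_fin ltW.
apply: ge0_le_integral_nonmeasurable => x Dx.
  by rewrite !mule_ge0 ?f0// lee_fin ltW.
by rewrite muleA -EFinM mulVf ?gt_eqF// mul1e.
Qed.

End lower_integral.

(** * Finiteness of the boundary measure *)

Section row_norm.
Context {R : realType} {n : nat}.
Local Notation E := ('rV[R]_n.+1).

Lemma le_coord_norm (v : E) k : `|v ord0 k| <= `|v|.
Proof.
rewrite [leRHS]/Num.Def.normr/= mx_normrE.
exact: (le_bigmax _ (fun ij : 'I_1 * 'I_n.+1 => `|v ij.1 ij.2|) (ord0, k)).
Qed.

Lemma row_norm_le (v : E) (c : R) : 0 <= c ->
  (forall k, `|v ord0 k| <= c) -> `|v| <= c.
Proof.
move=> c0 vc; rewrite [leLHS]/Num.Def.normr/= mx_normrE bigmax_le// => -[i k] _.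
by rewrite /= (ord1 i).
Qed.

Lemma quadratic_form_le (A : 'M[R]_n.+1) (v : E) :
  (v *m A *m v^T) ord0 ord0 <= (\sum_k \sum_l `|A k l|) * `|v| ^+ 2.
Proof.
rewrite mxE.
under eq_bigr => l _ do rewrite mxE big_distrl /=.
rewrite exchange_big big_distrl /=; apply: ler_sum => k _.
rewrite big_distrl /=; apply: ler_sum => l _.
apply: le_trans (ler_norm _) _; rewrite !normrM [X in X * _]mulrC -mulrA.
by rewrite ler_wpM2l// expr2 mxE ler_pM// le_coord_norm.
Qed.

End row_norm.

(** * Straight segments in a chart and their length *)

Section precomposition_with_a_line.
Context {R : realType} {V : normedModType R}.
Variables (y w : V).

Definition line (t : R) : V := t *: w + y.

Lemma line_shift (h s t : R) : line (h *: s + t) = h *: (s *: w) + line t.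
Proof. by rewrite /line scalerDl addrA scalerA. Qed.

Lemma differentiable_line t : differentiable line t.
Proof.
have -> : line = (fun t : R => t *: w) + cst y by [].
by apply: differentiableD => //; apply: (@differentiableZl _ _ _ id).
Qed.

Lemma continuous_line : continuous line.
Proof. by move=> t; apply: differentiable_continuous; exact: differentiable_line. Qed.

Lemma derive_line (F : V -> R) s t : 'D_s (F \o line) t = 'D_(s *: w) F (line t).
Proof.
rewrite /derive.
suff -> : (fun h : R => h^-1 *: (((F \o line) \o shift t) (h *: s) - (F \o line) t)) =
  (fun h : R => h^-1 *: ((F \o shift (line t)) (h *: (s *: w)) - F (line t))) by [].
by apply/funext => h /=; rewrite line_shift.
Qed.

Lemma iter_derive_line (F : V -> R) vs :
  iter_derive vs (F \o line) = iter_derive [seq s *: w | s <- vs] F \o line.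
Proof.
elim: vs => [//|s vs IH] /=; apply/funext => t.
by rewrite [iter_derive vs _]IH derive_line.
Qed.

Lemma smooth_on_line (U : set V) (F : V -> R) :
  smooth_on U F -> smooth_on (line @^-1` U) (F \o line).
Proof.
move=> sF vs t Ut; rewrite iter_derive_line.
by apply: differentiable_comp; [exact: differentiable_line|exact: sF].
Qed.

End precomposition_with_a_line.

Section straight_curves.
Context {R : realType} {n : nat} {M : topologicalType}.
Variables (X : smooth_atlas R n M) (g : riemannian_metric X).
Local Notation E := ('rV[R]_n.+1).
Variables (i : index X) (y w : E).
Hypothesis segment_in_chart : forall t : R, `[0, 1]%classic t ->
  chart_image i (line y w t).

Let c (t : R) : M := icoord i (line y w t).
Let D (j : index X) : set R := `[0, 1]%classic `&` c @^-1` dom j.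

Let overlap_line j t : D j t -> overlap i j (line y w t).
Proof. by move=> [t01 jt]; apply: overlapE => //; exact: segment_in_chart. Qed.

Let near_curve t (P : set M) : `[0, 1]%classic t -> nbhs (c t) P ->
  \forall s \near t, `[0, 1]%classic s -> P (c s).
Proof.
move=> t01 ctP.
have H := near_icoord (segment_in_chart t01) ctP.
have {}H : \forall s \near t, half_space (line y w s) -> P (c s).
  exact: (@continuous_line _ _ y w t _ H).
apply: filterS H => s H s01; apply: H.
exact: chart_image_half (segment_in_chart s01).
Qed.

Let approachable_curve j t : D j t -> approachable (D j) t 1.
Proof.
move=> [t01 jt].
have nD : \forall s \near t, `[0, 1]%classic s -> D j s.
  have := near_curve t01 (near_dom jt).
  by apply: filterS => s H s01; split=> //; exact: H.
have dir (s : R) : `|s| = 1 ->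
    (\forall h \near (0 : R), 0 < h -> 0 <= h * s + t <= 1) ->
    approachable (D j) t 1.
  move=> s1 st; apply: (approachable_dir s1).
  have := near_line s nD; apply: filterS2 st => h st Dh h0.
  by rewrite [X in D j (X + t)]mulr1 mulrC; apply: Dh; rewrite /= in_itv /=; exact: st.
move: (t01); rewrite /= in_itv /= => /andP[t0].
rewrite le_eqVlt => /predU1P[t1|t1].
  (* At the right end of the interval only negative increments are available; elsewhere positive
     ones are. *)
  apply: (dir (-1)); first by rewrite normrN1.
  have : \forall h \near (0 : R), h < 1 by exact: lt_nbhsl.
  by apply: filterS => h h1 h0; apply/andP; split; lra.
apply: (dir 1); first by rewrite normr1.
have : \forall h \near (0 : R), h < 1 - t by apply: lt_nbhsl; rewrite subr_gt0.
by apply: filterS => h h1 h0; apply/andP; split; lra.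
Qed.

Let curve_coord_extension j t k : D j t ->
  exists U (F : E -> R), [/\ open U, U (line y w t), smooth_on U F &
    forall x, U x -> overlap i j x -> F x = coord j (icoord i x) ord0 k].
Proof. by move=> /overlap_line /(transition_smooth k). Qed.

Lemma smooth_straight_curve : smooth_curve X c.
Proof.
split.
  apply/subspace_continuousP => t t01 P ctP.
  exact: (near_curve t01 ctP).
move=> j k t Dt.
have [U [F [oU Ux sF Ff]]] := curve_coord_extension k Dt.
exists (line y w @^-1` U), (F \o line y w); split=> //.
- by apply: open_comp => // s _; exact: continuous_line.
- exact: smooth_on_line.
- by move=> s Us Ds; rewrite /= Ff//; exact: overlap_line.
Qed.

(** The speed is defined in the chart chosen at [c t], where the velocity has coordinates [w *m J];
    the transformation rule of the metric carries the norm back to the chart [i]. *)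
Lemma straight_curve_speed t : `[0, 1]%classic t ->
  curve_speed g c t = tangent_norm g i (line y w t) w.
Proof.
move=> t01; rewrite /curve_speed; set j := chart_at X (c t).
have jt : dom j (c t) by exact: dom_chart_at.
have Dt : D j t by split.
have ot := overlap_line Dt.
set J := transition_jacobian i j (line y w t).
have -> : (\row_k derive_within (D j) (fun s : R => coord j (c s) ord0 k) t 1)
    = w *m J.
  apply/rowP => l; rewrite !mxE.
  have [U [F [oU Ux sF Ff]]] := curve_coord_extension l Dt.
  have dF : differentiable F (line y w t) by exact: (sF [::]).
  rewrite (@derive_withinE _ _ _ (line y w @^-1` U) _ (F \o line y w))//.
  - rewrite derive_line scale1r deriveE// diff_rV_sum//; apply: eq_bigr => m _.
    rewrite mxE (derive_withinE (approachable_overlap _ ot) oU Ux ot Ff)//.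
  - exact: approachable_curve.
  - by apply: open_comp => // s _; exact: continuous_line.
  - by move=> s Us Ds; rewrite /= Ff//; exact: overlap_line.
  - by apply: differentiable_comp => //; exact: differentiable_line.
rewrite /tangent_norm (metric_transition g ot) -/J.
by rewrite trmx_mul !mulmxA.
Qed.

Lemma straight_distance_le (C : R) :
  (forall t : R, `[0, 1]%classic t -> tangent_norm g i (line y w t) w <= C) ->
  (riemannian_distance g (c 0) (c 1) <= C%:E)%E.
Proof.
move=> speedC; apply: (@le_trans _ _ (curve_length g c)).
  apply: ereal_inf_lbound; rewrite -[curve_length g c]adde0.
  apply: joined_cons; first exact: smooth_straight_curve.
  exact: joined_nil.
rewrite /curve_length.
apply: (@le_trans _ _ (\int[lebesgue_measure]_(t in `[0%R, 1%R]) (cst C%:E t))%E).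
  apply: ge0_le_integral_nonmeasurable => t t01.
    by rewrite lee_fin /curve_speed sqrtr_ge0.
  by rewrite lee_fin straight_curve_speed// speedC.
rewrite integral_cst//= lebesgue_measure_itv /= lte_fin ltr01.
by rewrite oppr0 adde0 mule1.
Qed.

End straight_curves.

(** * Hausdorff measure of a set controlled by a Euclidean cube *)

Section hausdorff_bound.
Context {R : realType}.

Lemma unit_ball_volume_ge0 k : 0 <= unit_ball_volume R k.
Proof.
suff : 0 <= unit_ball_volume R k /\ 0 <= unit_ball_volume R k.+1 by case.
elim: k => [|k [IH1 IH2]]; first by rewrite /= ler01 ler0n.
split=> //; change (0 <= 2 * pi / k.+2%:R * unit_ball_volume R k).
by rewrite !mulr_ge0 ?invr_ge0 ?pi_ge0.
Qed.

Local Open Scope ereal_scope.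
Context {T : Type}.
Variables (d : T -> T -> \bar R) (n : nat).
Hypothesis d_ge0 : forall x y, 0 <= d x y.

Lemma diameter_bound (C : set T) (e : R) : (0 <= e)%R -> C !=set0 ->
  (forall x y, C x -> C y -> d x y <= e%:E) -> 0 <= diameter d C <= e%:E.
Proof.
move=> e0 [x Cx] Ce; apply/andP; split.
  apply: le_trans (d_ge0 x x) _; apply: ereal_sup_ubound.
  by exists x => //; exists x.
by apply: ge_ereal_sup => _ [y Cy [z Cz <-]]; exact: Ce.
Qed.

Lemma hausdorff_weight_ge0 C : 0 <= hausdorff_weight d n C.
Proof.
rewrite /hausdorff_weight; case: ifPn => // C0; rewrite lee_fin.
rewrite mulr_ge0 ?unit_ball_volume_ge0// exprn_ge0// divr_ge0// fine_ge0//.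
have /set0P[x Cx] := C0.
apply: le_trans (d_ge0 x x) _; apply: ereal_sup_ubound.
by exists x => //; exists x.
Qed.

Lemma hausdorff_weight_le (C : set T) (e : R) : (0 <= e)%R ->
  (forall x y, C x -> C y -> d x y <= e%:E) ->
  hausdorff_weight d n C <= (unit_ball_volume R n * (e / 2) ^+ n)%:E.
Proof.
move=> e0 Ce; have K0 : (0 <= unit_ball_volume R n * (e / 2) ^+ n)%R.
  by rewrite mulr_ge0 ?unit_ball_volume_ge0// exprn_ge0// divr_ge0.
rewrite /hausdorff_weight; case: ifPn => [_|C0]; first by rewrite lee_fin.
have /set0P C0' := C0; have /andP[d0 de] := diameter_bound e0 C0' Ce.
have dfin : diameter d C \is a fin_num.
  by rewrite ge0_fin_numE// (le_lt_trans de)// ltry.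
rewrite lee_fin ler_wpM2l ?unit_ball_volume_ge0// lerXn2r ?nnegrE ?divr_ge0//.
  exact: fine_ge0.
by rewrite ler_pM2r ?invr_gt0// -lee_fin fineK.
Qed.

Lemma nneseries_le_const (f : nat -> \bar R) (m : nat) (K : R) : (0 <= K)%R ->
  (forall j, 0 <= f j) -> (forall j, f j <= K%:E) ->
  (forall j, (m <= j)%N -> f j = 0) -> \sum_(j <oo) f j <= (m%:R * K)%:E.
Proof.
move=> K0 f0 fK fm; apply: lime_le; first exact: is_cvg_nneseries.
apply: nearW => N; suff : \sum_(0 <= j < N) f j <= ((minn N m)%:R * K)%:E.
  move=> /le_trans; apply; rewrite lee_fin ler_wpM2r// ler_nat.
  exact: geq_minr.
elim: N => [|N IH]; first by rewrite big_nil min0n mul0r.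
rewrite big_nat_recr//=; have [Nm|mN] := ltnP N m.
  rewrite (minn_idPl Nm) -natr1 mulrDl mul1r EFinD leeD//.
  by rewrite (minn_idPl (ltnW Nm)) in IH.
rewrite fm// adde0 (le_trans IH)// lee_fin ler_wpM2r// ler_nat.
by rewrite (minn_idPr mN) (minn_idPr (leqW mN)).
Qed.

(* Cut the cube of half-side [r] around [a] into [N ^ n] cubes of side
   [2 * r / N]; their total weight does not depend on [N]. *)
Lemma hausdorff_measure_cube_le (A : set T) (phi : T -> 'I_n -> R)
    (a : 'I_n -> R) (C r : R) : (0 <= C)%R -> (0 < r)%R ->
  (forall x, A x -> forall k, (`|phi x k - a k| < r)%R) ->
  (forall (e : R) x y, (0 <= e)%R -> A x -> A y ->
    (forall k, (`|phi x k - phi y k| <= e)%R) -> d x y <= (C * e)%:E) ->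
  hausdorff_measure d n A <= (unit_ball_volume R n * (C * r) ^+ n)%:E.
Proof.
move=> C0 r0 Ar Ad; apply: ge_ereal_sup => _ [delta /= delta0 <-].
(* A cell of side [side] has diameter at most [C * side] for [d], and this [N] makes that at most
   [delta]. *)
pose N := (Num.bound (2 * C * r / delta)).+1.
have N0 : (0 < N%:R :> R)%R by rewrite ltr0n.
pose side : R := (2 * r / N%:R)%R.
have side0 : (0 < side)%R by rewrite divr_gt0// mulr_gt0.
have side_delta : (C * side <= delta)%R.
  have q0 : (0 <= 2 * C * r / delta)%R.
    by rewrite !mulr_ge0 ?invr_ge0// ltW.
  have : (2 * C * r / delta <= N%:R)%R.
    by apply: ltW; apply: lt_le_trans (archi_boundP q0) _; rewrite ler_nat.
  rewrite ler_pdivrMr// => qN.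
  rewrite /side mulrA ler_pdivrMr// mulrA [(C * 2)%R]mulrC.
  by rewrite [(delta * _)%R]mulrC.
pose cell x k := ((phi x k - a k + r) / side)%R.
have cell_itv x k : A x -> (0 <= cell x k < N%:R)%R.
  move=> Ax; have := Ar x Ax k; rewrite ltr_norml => /andP[l1 l2].
  rewrite divr_ge0 ?(ltW side0)//=; last by lra.
  rewrite ltr_pdivrMr// /side mulrCA mulrV ?mulr1; last first.
    by rewrite unitfE gt_eqF.
  lra.
pose key x : {ffun 'I_n -> 'I_N} := [ffun k => inord (Num.truncn (cell x k))].
have key_close x y k : A x -> A y -> key x = key y ->
    (`|phi x k - phi y k| <= side)%R.
  move=> Ax Ay /ffunP /(_ k); rewrite !ffunE => /(congr1 val) /=.
  have /andP[cx0 cxN] := cell_itv x k Ax; have /andP[cy0 cyN] := cell_itv y k Ay.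
  rewrite !inordK ?truncn_lt_nat// => txy.
  have /andP[x1 x2] := truncn_itv cx0; have /andP[y1 y2] := truncn_itv cy0.
  rewrite txy in x1 x2.
  have : (`|cell x k - cell y k| <= 1)%R.
    by move: x1 x2 y1 y2; rewrite -natr1 ler_norml => *; apply/andP; split; lra.
  rewrite /cell -mulrBl normrM normfV (gtr0_norm side0) ler_pdivrMr// mul1r.
  by congr (`|_| <= _)%R; ring.
(* The cells are enumerated along the natural numbers; from index [N ^ n] on the sets are empty and
   have weight 0. *)
pose cover j := [set x | A x /\ seq.index (key x) (enum {: {ffun 'I_n -> 'I_N}}) = j].
have cover_d j x y : cover j x -> cover j y -> d x y <= (C * side)%:E.
  move=> [Ax xj] [Ay yj]; apply: Ad => //; first exact: ltW.
  move=> k; apply: key_close => //.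
  have in_enum z : key z \in enum {: {ffun 'I_n -> 'I_N}} by rewrite mem_enum.
  by rewrite -(nth_index (key x) (in_enum x)) xj -yj nth_index.
have Cs0 : (0 <= C * side)%R by rewrite mulr_ge0// ltW.
apply: (@le_trans _ _ (\sum_(j <oo) hausdorff_weight d n (cover j))).
  apply: ereal_inf_lbound; exists cover => //; split.
    by move=> x Ax; exists (seq.index (key x) (enum {: {ffun 'I_n -> 'I_N}})).
  move=> j; apply: ge_ereal_sup => _ [x xj [y yj <-]].
  by rewrite (le_trans (cover_d j x y xj yj))// lee_fin.
apply: le_trans (@nneseries_le_const _ (N ^ n)%N
  (unit_ball_volume R n * (C * side / 2) ^+ n)%R _ _ _ _) _.
- by rewrite mulr_ge0 ?unit_ball_volume_ge0// exprn_ge0// divr_ge0.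
- by move=> j; exact: hausdorff_weight_ge0.
- by move=> j; apply: hausdorff_weight_le => // x y; exact: cover_d.
- move=> j jN; rewrite /hausdorff_weight; case: ifPn => // /set0P[x [Ax xj]].
  have := index_mem (key x) (enum {: {ffun 'I_n -> 'I_N}}).
  rewrite mem_enum xj -cardE card_ffun !card_ord => /idP.
  by rewrite ltnNge jN.
(* The number of cells cancels: [N * (C * side / 2) = C * r]. *)
rewrite lee_fin natrX mulrCA -exprMn le_eqVlt; apply/orP; left; apply/eqP.
by congr (_ * _ ^+ _)%R; rewrite /side; field; rewrite gt_eqF.
Qed.

End hausdorff_bound.

(** * Local and global finiteness of the boundary measure *)

Section finite_boundary_measure.
Context {R : realType} {n : nat} {M : ptopologicalType}.
Variables (X : smooth_atlas R n M) (g : riemannian_metric X).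
Local Notation E := ('rV[R]_n.+1).

Lemma riemannian_distance_ge0 q r : (0 <= riemannian_distance g q r)%E.
Proof.
apply: le_ereal_inf_tmp => l; elim=> [//|c r' l' _ _ IH].
rewrite adde_ge0// integral_ge0// => t _; rewrite lee_fin; exact: sqrtr_ge0.
Qed.

(** The coefficients of the metric have continuous extensions, so near [x] each exceeds its absolute
    value at [x] by at most 1, and these bounds control the quadratic form. *)
Lemma near_tangent_norm_le i (x : E) : chart_image i x ->
  exists2 C : R, 0 <= C & \forall y \near x, half_space y ->
    forall v, tangent_norm g i y v <= C * `|v|.
Proof.
move=> ix.
have gkl k l : \forall y \near x, half_space y ->
    `|metric g i y k l| <= `|metric g i x k l| + 1.
  have [U [F [oU Ux sF Ff]]] := metric_smooth g k l ix.
  have cF : F @ x --> F x by apply: differentiable_continuous; exact: (sF [::]).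
  have FF : \forall y \near x, `|F y - F x| < 1.
    exact: (cvgr_distC_lt _ _ cF _ ltr01).
  have nU : \forall y \near x, U y by exact: open_nbhs_nbhs.
  have ni := near_chart_image ix.
  near=> y => Hy.
  have iy : chart_image i y by move: Hy; apply: (near ni y).
  have Uy : U y by apply: (near nU y).
  have Fy : `|F y - F x| < 1 by apply: (near FF y).
  rewrite -(Ff y)// -(Ff x)// -lerBlDl.
  by apply: ltW; apply: le_lt_trans Fy; exact: lerB_dist.
pose B := \sum_k \sum_l (`|metric g i x k l| + 1).
have B0 : 0 <= B.
  by apply: sumr_ge0 => k _; apply: sumr_ge0 => l _; rewrite addr_ge0.
exists (Num.sqrt B); first exact: sqrtr_ge0.
have H : \forall y \near x, forall kl : 'I_n.+1 * 'I_n.+1, half_space y ->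
    `|metric g i y kl.1 kl.2| <= `|metric g i x kl.1 kl.2| + 1.
  apply: (@filter_forall _ _ (fun kl y => half_space y ->
    `|metric g i y kl.1 kl.2| <= `|metric g i x kl.1 kl.2| + 1) (nbhs x)) => kl.
  exact: gkl.
apply: filterS H => y H Hy v; rewrite /tangent_norm.
rewrite -[leRHS](ger0_norm) ?mulr_ge0 ?sqrtr_ge0// -sqrtr_sqr ler_sqrt ?sqr_ge0//.
rewrite exprMn sqr_sqrtr//; apply: le_trans (quadratic_form_le _ _) _.
rewrite ler_wpM2r ?sqr_ge0//; apply: ler_sum => k _; apply: ler_sum => l _.
exact: (H (k, l)).
Unshelve. all: by end_near. Qed.

(** In a small coordinate ball the boundary is part of a hyperplane, and the distance of two of its
    points is at most the length of the segment between them, a multiple of their coordinate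
    distance. *)
Lemma locally_finite_boundary_measure q : exists U : set M,
  [/\ open U, U q & exists K : R,
   (hausdorff_measure (riemannian_distance g) n (U `&` boundary X) <= K%:E)%E].
Proof.
pose i := chart_at X q; have qi : dom i q by exact: dom_chart_at.
set x := coord i q; have ix : chart_image i x by exact: coord_dom_image.
have [C C0 nC] := near_tangent_norm_le ix.
have /nbhs_ballP[r /= r0 hr] : \forall y \near x, half_space y ->
    chart_image i y /\ forall v, tangent_norm g i y v <= C * `|v|.
  have := near_chart_image ix.
  by apply: filterS2 nC => y h1 h2 Hy; split; [exact: h2|exact: h1].
have ballE (y : E) : ball x r y <-> `|x - y| < r by rewrite mx_norm_ball.
pose O : set M := [set q' | dom i q' /\ ball x r (coord i q')].
have Oq : nbhs q O.
  have nb : \forall q' \near q, ball x r (coord i q').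
    by apply: (coord_cvg qi); exact: nbhsx_ballx.
  by have := near_dom qi; apply: filterS2 nb => q' h1 h2; split.
exists O°; split; [exact: open_interior|exact: Oq|].
exists (unit_ball_volume R n * (C * r) ^+ n).
(* The [n] parameters are all coordinates but the first, which vanishes on the boundary. *)
apply: (@hausdorff_measure_cube_le _ _ _ _ _ _
  (fun q' k => coord i q' ord0 (lift ord0 k)) (fun k => x ord0 (lift ord0 k))) => //.
- exact: riemannian_distance_ge0.
- move=> q' [/interior_subset[q'i /ballE xr] _] k; rewrite distrC.
  apply: le_lt_trans xr.
  by have := le_coord_norm (x - coord i q') (lift ord0 k); rewrite !mxE.
move=> e q1 q2 e0 [/interior_subset[q1i b1] q1b] [/interior_subset[q2i b2] q2b] e12.
set y := coord i q1 in b1 e12; set z := coord i q2 in b2 e12.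
have y0 : y ord0 ord0 = 0 by exact: boundary_coord.
have z0 : z ord0 ord0 = 0 by exact: boundary_coord.
have we : `|z - y| <= e.
  apply: row_norm_le => // k; rewrite !mxE.
  case: (unliftP ord0 k) => [j ->|->]; first by rewrite distrC.
  by rewrite y0 z0 subrr normr0.
(* The segment stays in the wall of the half-space because both ends do, and in the ball by
   convexity. *)
have seg t : `[0, 1]%classic t -> half_space (line y (z - y) t) /\
    ball x r (line y (z - y) t).
  rewrite /= in_itv /= => /andP[t0 t1]; split.
    by rewrite /half_space /line /= !mxE y0 z0 subrr mulr0 addr0.
  apply/ballE; move/ballE: b1 => b1; move/ballE: b2 => b2.
  have -> : x - line y (z - y) t = (1 - t) *: (x - y) + t *: (x - z).
    rewrite /line; apply/rowP => k; rewrite !mxE; ring.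
  apply: le_lt_trans (ler_normD _ _) _; rewrite !normrZ.
  rewrite (ger0_norm t0) ger0_norm ?subr_ge0//.
  move: t0; rewrite le_eqVlt => /predU1P[<-|t0].
    by rewrite subr0 mul1r mul0r addr0.
  have h1 : (1 - t) * `|x - y| <= (1 - t) * r.
    by rewrite ler_wpM2l ?subr_ge0// ltW.
  have h2 : t * `|x - z| < t * r by rewrite ltr_pM2l.
  by lra.
have q1E : q1 = icoord i (line y (z - y) 0) by rewrite /line scale0r add0r icoordK.
have q2E : q2 = icoord i (line y (z - y) 1) by rewrite /line scale1r subrK icoordK.
rewrite q1E q2E; apply: straight_distance_le.
  by move=> t /seg[Ht bt]; have [] := hr _ bt Ht.
move=> t /seg[Ht bt]; have [_ h] := hr _ bt Ht.
by apply: le_trans (h _) _; rewrite ler_wpM2l.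
Qed.

Lemma boundary_measure_finite (surf : {measure set (borel M) -> \bar R}) :
  compact [set: M] -> is_boundary_measure g surf ->
  (surf [set: M] < +oo)%E.
Proof.
move=> cM surfE.
have /choice[U HU] := locally_finite_boundary_measure.
have mU q : measurable (U q : set (borel M)).
  by apply: sub_sigma_algebra; have [] := HU q.
have SU q : (surf (U q) < +oo)%E.
  rewrite surfE//; have [_ _ [K HK]] := HU q.
  by apply: le_lt_trans HK _; rewrite ltry.
move: cM; rewrite compact_cover => /(_ M [set: M] U).
case=> [q _|q _|D _ Dcov]; first by have [] := HU q.
  by exists q => //; have [] := HU q.
have SD (s : seq M) : (surf (\big[setU/set0]_(q <- s) U q) < +oo)%E /\
    measurable (\big[setU/set0]_(q <- s) U q : set (borel M)).
  elim: s => [|q s [IH1 IH2]]; first by rewrite big_nil measure0.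
  rewrite big_cons; split; last exact: measurableU.
  apply: (le_lt_trans (measureU2 surf (mU q) IH2)).
  exact: lte_add_pinfty (SU q) IH1.
have -> : [set: M] = \big[setU/set0]_(q <- finmap.enum_fset D) U q.
  by rewrite -bigcup_fset; apply/seteqP; split=> // q Mq; exact: Dcov.
by have [] := SD (finmap.enum_fset D).
Qed.

End finite_boundary_measure.

(** * The upper bound *)

Section power_inequalities.
Context {R : realType}.
Implicit Types (p q a b c y s : R).

(** The tangent at 1 of the convex power function, read off from Young's inequality for [y * 1] with
    conjugate exponents [p] and [p / (p - 1)]. *)
Lemma bernoulli_powR p y : 1 < p -> 0 <= y -> p * y - (p - 1) <= y `^ p.
Proof.
move=> p1 y0; have p0 : 0 < p by exact: lt_trans p1.
have p10 : 0 < p - 1 by rewrite subr_gt0.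
pose q := p / (p - 1); have q0 : 0 < q by rewrite divr_gt0.
have pq : p^-1 + q^-1 = 1.
  by rewrite /q invf_div; field; rewrite gt_eqF.
have := conjugate_powR y0 ler01 p0 q0 pq.
rewrite mulr1 powR1 mul1r /q invf_div => H.
have : p * y <= p * (y `^ p / p + (p - 1) / p) by rewrite ler_pM2l.
have -> : p * (y `^ p / p + (p - 1) / p) = y `^ p + (p - 1).
  by field; rewrite gt_eqF.
lra.
Qed.

(** Add the Bernoulli inequalities at [2 * (1 - c)] and [2 * c]: the linear terms sum to the
    constant 2, whatever [c] is. *)
Lemma powR_split_le p c : 1 < p -> 0 <= c <= 1 ->
  2 `^ (1 - p) <= (1 - c) `^ p + c `^ p.
Proof.
move=> p1 /andP[c0 c1].
have h1 := @bernoulli_powR p (2 * (1 - c)) p1.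
have h2 := @bernoulli_powR p (2 * c) p1.
rewrite !powRM ?subr_ge0// in h1 h2.
have {}h1 := h1 (mulr_ge0 (ler0n _ 2) (etrans (subr_ge0 _ _) c1)).
have {}h2 := h2 (mulr_ge0 (ler0n _ 2) c0).
have t0 : (0 : R) < 2 `^ p by rewrite powR_gt0.
rewrite powRB ?pnatr_eq0 ?implybT// powRr1// ler_pdivrMr//.
nra.
Qed.

(** The supporting line at [a] of the convex function [|.|] to the power [p]; for [a] nonzero,
    divide by the value at [a] and apply Bernoulli to [|1 - c / a|]. *)
Lemma tangent_powR p a c : 1 < p ->
  `|a| `^ p - p * c * (`|a| `^ (p - 2) * a) <= `|a - c| `^ p.
Proof.
move=> p1; have p0 : 0 < p by exact: lt_trans p1.
have [->|a0] := eqVneq a 0.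
  by rewrite normr0 powR0 ?gt_eqF// !mulr0 subrr powR_ge0.
have na0 : 0 < `|a| by rewrite normr_gt0.
have aE : `|a| `^ (p - 2) * a = `|a| `^ p * a^-1.
  rewrite powRB ?normr_eq0 ?a0 ?implybT// powR_mulrn// real_normK ?num_real//.
  by field.
have -> : `|a - c| = `|a| * `|1 - c / a|.
  by rewrite -normrM mulrBr mulr1 mulrCA divff ?mulr1.
rewrite powRM// aE.
have -> : `|a| `^ p - p * c * (`|a| `^ p * a^-1) = `|a| `^ p * (1 - p * (c / a)).
  by ring.
rewrite ler_wpM2l ?powR_ge0//; apply: le_trans (bernoulli_powR p1 _) => //.
have : 1 - c / a <= `|1 - c / a| by exact: ler_norm.
nra.
Qed.

(** The exponent may be negative: the lemma is applied with [q = p - 2]. *)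
Lemma continuous_norm_powR_neq0 q s : s != 0 ->
  {for s, continuous (fun s : R => `|s| `^ q)}.
Proof.
move=> s0; rewrite /continuous_at.
apply: (@cvg_comp _ _ _ (fun s : R => `|s|) (fun y : R => y `^ q) _ (nbhs (`|s| : R))).
  exact: norm_continuous.
have : derivable (fun y : R => y `^ q) `|s| 1.
  by apply: derivable_powR; rewrite in_itv /= andbT normr_gt0.
by move=> /derivable1_diffP /differentiable_continuous.
Qed.

Lemma continuous_norm_powR q : 0 < q -> continuous (fun s : R => `|s| `^ q).
Proof.
move=> q0 s; have [->|s0] := eqVneq s 0.
  rewrite /continuous_at normr0 powR0 ?gt_eqF//; apply/cvgr0Pnorm_lt => e e0.
  have d0 : 0 < e `^ q^-1 by rewrite powR_gt0.
  have H : \forall t \near (0 : R), `|t| < e `^ q^-1 by exact: nbhs0_lt.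
  apply: filterS H => t te; rewrite ger0_norm ?powR_ge0//.
  have -> : e = (e `^ q^-1) `^ q by rewrite -powRrM mulVf ?gt_eqF// powRr1 ?ltW.
  by apply: gt0_ltr_powR; rewrite ?nnegrE// ltW.
exact: continuous_norm_powR_neq0.
Qed.

(** The integrand of the eigenvalue constraint; up to the factor [p] it is the derivative of the
    [p]-th power of the absolute value. *)
Definition signed_power p s : R := `|s| `^ (p - 2) * s.

Lemma norm_signed_power p s : 1 < p -> `|signed_power p s| = `|s| `^ (p - 1).
Proof.
move=> p1; rewrite /signed_power normrM ger0_norm ?powR_ge0//.
have [->|s0] := eqVneq s 0.
  by rewrite !normr0 mulr0 powR0// gt_eqF// subr_gt0.
rewrite -[X in _ * X]powRr1// -powRD; last by rewrite normr_eq0 s0 implybT.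
by congr (_ `^ _); ring.
Qed.

Lemma continuous_signed_power p : 1 < p -> continuous (signed_power p).
Proof.
move=> p1 s; have [->|s0] := eqVneq s 0.
  have sp0 : signed_power p 0 = 0 by rewrite /signed_power mulr0.
  rewrite /continuous_at sp0; apply/cvgr0Pnorm_lt => e e0.
  have p10 : 0 < p - 1 by rewrite subr_gt0.
  have := @continuous_norm_powR _ p10 0; rewrite /continuous_at normr0 powR0 ?gt_eqF//.
  move=> /cvgr0Pnorm_lt /(_ e e0); apply: filterS => t.
  by rewrite norm_signed_power// ger0_norm ?powR_ge0.
apply: (@continuousM _ _ (fun s : R => `|s| `^ (p - 2)) id) => //.
exact: continuous_norm_powR_neq0.
Qed.

End power_inequalities.

Section continuous_functions_on_compact_spaces.
Context {R : realType} {M : ptopologicalType}.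
Variables (S : {measure set (borel M) -> \bar R}) (D : set M).
Hypotheses (cM : compact [set: M]) (mD : measurable (D : set (borel M))).
Hypothesis S_fin : (S [set: M] < +oo)%E.
Implicit Types (f u : M -> R).

Lemma open_borel (U : set M) : open U -> measurable (U : set (borel M)).
Proof. by move=> oU; exact: sub_sigma_algebra. Qed.

Lemma closed_borel (C : set M) : closed C -> measurable (C : set (borel M)).
Proof.
move=> cC; rewrite -[C]setCK; apply: measurableC; apply: open_borel.
exact: closed_openC.
Qed.

Lemma continuous_borel_measurable f : continuous f ->
  measurable_fun [set: borel M] (f : borel M -> R).
Proof.
move=> cf; apply: (measurability _ (RGenOpens.measurableE R)) => // _ [_ [a [b ->]] <-].
rewrite setTI; apply: open_borel.
by apply: open_comp => [x _|]; [exact: cf|exact: interval_open].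
Qed.

Lemma continuous_bounded f : continuous f -> exists K : R, forall x, `|f x| <= K.
Proof.
move=> cf; have : compact (f @` [set: M]).
  by apply: continuous_compact => //; exact: continuous_subspaceT.
move=> /compact_bounded[K [_ HK]]; exists (K + 1) => x.
by apply: (HK (K + 1)); [rewrite ltrDl|exists x].
Qed.

Lemma finite_measure_le (A : set M) : measurable (A : set (borel M)) -> (S A < +oo)%E.
Proof.
move=> mA; apply: le_lt_trans S_fin; apply: le_measure => //; rewrite ?inE//.
Qed.

Lemma continuous_integrable f : continuous f ->
  S.-integrable (D : set (borel M)) (EFin \o f).
Proof.
move=> cf; apply: measurable_bounded_integrable => //.
- exact: finite_measure_le.
- by apply: measurable_funTS; exact: continuous_borel_measurable.
have [K HK] := continuous_bounded cf.
exists K; split; first exact: num_real.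
by move=> K' KK' x _; apply: (le_trans (HK x)); exact: ltW.
Qed.

End continuous_functions_on_compact_spaces.

(** * Existence of the centering constant *)

Section signed_power_mean.
Context {R : realType} {M : ptopologicalType}.
Variables (S : {measure set (borel M) -> \bar R}) (D : set M).
Hypotheses (cM : compact [set: M]) (mD : measurable (D : set (borel M))).
Hypothesis S_fin : (S [set: M] < +oo)%E.
Variable p : R.
Hypothesis p1 : 1 < p.

Lemma continuous_signed_power_comp (u : M -> R) (c : R) : continuous u ->
  continuous (fun x => signed_power p (u x - c)).
Proof.
move=> cu x; apply: (@cvg_comp _ _ _ (fun x => u x - c) (signed_power p) _
  (nbhs (u x - c))); last exact: continuous_signed_power.
by apply: cvgB; [exact: cu|exact: cvg_cst].
Qed.

Lemma continuous_norm_powR_comp (u : M -> R) (c : R) : continuous u ->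
  continuous (fun x => `|u x - c| `^ p).
Proof.
move=> cu x; apply: (@cvg_comp _ _ _ (fun x => u x - c) (fun y : R => `|y| `^ p) _
  (nbhs (u x - c))).
  by apply: cvgB; [exact: cu|exact: cvg_cst].
by apply: continuous_norm_powR; exact: lt_trans p1.
Qed.

(** Intermediate value theorem in [c]: with [|u| <= K], the integrand is nonnegative at [c = - K]
    and nonpositive at [c = K]; continuity in [c] comes from dominated convergence. *)
Lemma signed_power_mean_exists (u : M -> R) : continuous u ->
  exists c : R,
    (\int[S]_(x in (D : set (borel M))) (signed_power p (u x - c))%:E = 0)%E.
Proof.
move=> cu; have [K HK] := continuous_bounded cM cu.
have K0 : 0 <= K by rewrite (le_trans _ (HK point)).
pose f c x := signed_power p (u x - c).
pose Phi c : R := \int[S]_(x in (D : set (borel M))) f c x.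
have p10 : 0 <= p - 1 by rewrite subr_ge0 ltW.
have int_f c : S.-integrable (D : set (borel M)) (EFin \o f c).
  by apply: continuous_integrable => //; exact: continuous_signed_power_comp.
(* An open interval containing [[- K, K]], on which [|u - c| <= 2 * K + 1] supplies a dominating
   constant. *)
pose I : set R := `](- (K + 1)), (K + 1)[%classic.
have cPhi : {in I, continuous Phi}.
  apply: (@continuity_under_integral _ _ _ S f D mD _ _ _ _
    (fun=> (2 * K + 1) `^ (p - 1))).
  - by move=> c _; exact: int_f.
  - apply: aeW => x _ c _; apply: (@cvg_comp _ _ _ (fun c => u x - c) (signed_power p) _
      (nbhs (u x - c))); last exact: continuous_signed_power.
    by apply: cvgB => //; exact: cvg_cst.
  - by apply: continuous_integrable => //; exact: cst_continuous.
  - move=> c; rewrite /= in_itv /= => /andP[c1 c2]; apply: aeW => x _.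
    rewrite /f norm_signed_power// ge0_ler_powR ?nnegrE//.
      by rewrite addr_ge0// mulr_ge0.
    apply: le_trans (ler_normB _ _) _; have := HK x => uK.
    have : `|c| <= K + 1 by rewrite ler_norml; apply/andP; split; lra.
    lra.
have sp_ge0 s : 0 <= s -> 0 <= signed_power p s.
  by move=> s0; rewrite mulr_ge0 ?powR_ge0.
have spN s : signed_power p (- s) = - signed_power p s.
  by rewrite /signed_power normrN mulrN.
have PhiL : 0 <= Phi (- K).
  apply: Rintegral_ge0 => x _; apply: sp_ge0.
  by have := HK x; rewrite ler_norml => /andP[]; lra.
have PhiR : Phi K <= 0.
  rewrite -oppr_ge0 -mulN1r -RintegralZl//; apply: Rintegral_ge0 => x _.
  have uK : u x - K <= 0 by have := HK x; rewrite ler_norml => /andP[]; lra.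
  by rewrite mulN1r /f -spN sp_ge0// oppr_ge0.
have [] := @IVT _ Phi (- K) K 0.
- by rewrite lerNl (le_trans _ K0)// oppr_le0.
- apply: continuous_in_subspaceT => c; rewrite inE /= ?in_itv /= => /andP[c1 c2].
  by apply: cPhi; rewrite inE /I /= ?in_itv /=; apply/andP; split; lra.
- by rewrite ge_min le_max PhiL PhiR orbT.
move=> c _ Phic; exists c.
rewrite -[LHS]fineK; last by apply: integrable_fin_num => //; exact: int_f.
by rewrite -[fine _]/(Phi c) Phic.
Qed.

End signed_power_mean.

(** * Capacity test functions as test functions for the eigenvalue *)

Section upper_bound.
Context {R : realType} {n : nat} {M : ptopologicalType}.
Variables (X : smooth_atlas R n M) (g : riemannian_metric X).
Variables (vol surf : {measure set (borel M) -> \bar R}) (p : R).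
Hypotheses (hM : hausdorff_space M) (cM : compact [set: M]).
Hypothesis surf_fin : (surf [set: M] < +oo)%E.
Hypothesis p1 : 1 < p.
Local Open Scope ereal_scope.
Implicit Types (u : M -> R) (A B : set M).

Let p0 : (0 < p)%R. Proof. exact: lt_trans p1. Qed.

Lemma measurable_boundary : measurable (boundary X : set (borel M)).
Proof. by apply: closed_borel; exact: closed_boundary. Qed.

Lemma compact_borel A : compact A -> measurable (A : set (borel M)).
Proof. by move=> cA; apply: closed_borel; exact: compact_closed. Qed.

Lemma areaE A : measurable (A : set (borel M)) -> area surf A = surf A.
Proof. by move=> mA; rewrite /area integral_cst// mul1e. Qed.

Lemma energy_ge0 u : 0 <= energy g vol p u.
Proof. by apply: integral_ge0 => x _; rewrite lee_fin powR_ge0. Qed.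

Lemma gradient_norm_ge0 u q : (0 <= gradient_norm g u q)%R.
Proof. exact: sqrtr_ge0. Qed.

Lemma smooth_function_affine (a b : R) u : smooth_function X u ->
  smooth_function X (fun x => a * u x + b)%R.
Proof. by move=> su; apply: (smooth_function_comp (smooth_real_affine a b) su). Qed.

Lemma is_derive_affine (a b y : R) : is_derive y (1%R : R) (fun y : R => a * y + b)%R a.
Proof.
have d1 := is_deriveD (is_deriveZ a (is_derive_id y (1%R : R)))
  (is_derive_cst b y (1%R : R)).
by apply: is_derive_eq d1 _; rewrite addr0 [LHS]mulr1.
Qed.

Lemma gradient_norm_affine (a b : R) u q : smooth_function X u ->
  gradient_norm g (fun x => a * u x + b)%R q = (`|a| * gradient_norm g u q)%R.
Proof.
by move=> su; have := gradient_norm_comp g su (is_derive_affine a b (u q)).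
Qed.

Lemma energy_affine (a b : R) u : smooth_function X u -> `|a|%R = 1%R ->
  energy g vol p (fun x => a * u x + b)%R = energy g vol p u.
Proof.
move=> su a1; apply: eq_integral => x _.
by rewrite gradient_norm_affine// a1 mul1r.
Qed.

Lemma steklov_quotientE u (r : R) : (0 < r)%R ->
  \int[surf]_(x in boundary X) (`|u x| `^ p)%:E = r%:E ->
  steklov_quotient g vol surf p u = energy g vol p u * (r^-1)%:E.
Proof.
by move=> r0 rE; rewrite /steklov_quotient rE eqe gt_eqF// inver gt_eqF.
Qed.

Lemma boundary_powR_integrable u (c : R) : continuous u ->
  surf.-integrable (boundary X : set (borel M))
    (EFin \o (fun x => `|u x - c| `^ p)%R).
Proof.
move=> cu; apply: continuous_integrable => //; first exact: measurable_boundary.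
exact: continuous_norm_powR_comp.
Qed.

Lemma powR_integral_ge A B u (c m : R) : compact A -> A `<=` boundary X ->
  compact B -> B `<=` boundary X -> continuous u ->
  (forall x, A x -> 1 <= u x)%R -> (forall x, B x -> u x <= 0)%R ->
  (0 < m)%R -> m%:E <= surf A -> m%:E <= surf B ->
  (2 `^ (1 - p) * m)%:E <=
  \int[surf]_(x in boundary X) (`|u x - c| `^ p)%:E.
Proof.
move=> cA AX cB BX cu uA uB m0 mA mB.
have mbX := measurable_boundary.
have bA := compact_borel cA; have bB := compact_borel cB.
(* [a] and [b] are pointwise lower bounds on [A] and [B]. If [c] is outside [[0, 1]], one of them is
   0 and the other is at least 1. *)
pose a : R := if (c <= 1)%R then (`|1 - c| `^ p)%R else 0%R.
pose b : R := if (0 <= c)%R then (`|c| `^ p)%R else 0%R.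
have a0 : (0 <= a)%R by rewrite /a; case: ifP => // _; exact: powR_ge0.
have b0 : (0 <= b)%R by rewrite /b; case: ifP => // _; exact: powR_ge0.
have ab : (2 `^ (1 - p) <= a + b)%R.
  have t1 : (2 `^ (1 - p) <= 1 :> R)%R.
    rewrite -[leRHS](@powRr0 R 2) ler_powR ?ler1n// subr_le0; exact: ltW.
  rewrite /a /b; have [c1|c1] := leP c 1%R; last first.
    rewrite (ltW (lt_trans ltr01 c1)) add0r (le_trans t1)//.
    rewrite -[leLHS](@powRr0 R `|c|%R) ler_powR ?(ltW p0)//.
    by rewrite (le_trans (ltW c1))// ler_norm.
  have [c0|c0] := leP 0%R c; last first.
    rewrite addr0 (le_trans t1)// -[leLHS](@powRr0 R `|1 - c|%R) ler_powR ?(ltW p0)//.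
    by apply: le_trans (ler_norm _); lra.
  rewrite !ger0_norm ?subr_ge0//; apply: powR_split_le => //.
  by rewrite c0.
have lower x : boundary X x ->
    (a * \1_A x)%:E + (b * \1_B x)%:E <= (`|u x - c| `^ p)%:E.
  move=> _; rewrite -EFinD lee_fin !indicE.
  have [xA|xA] := boolP (x \in A); have [xB|xB] := boolP (x \in B).
  - move/set_mem: xA => /uA h; move/set_mem: xB => /uB h'; lra.
  - move/set_mem: xA => /uA h; rewrite mulr1 mulr0 addr0 /a.
    case: ifPn => c1; last exact: powR_ge0.
    rewrite ge0_ler_powR ?nnegrE ?(ltW p0)//.
    rewrite !ger0_norm ?subr_ge0//; [lra|exact: le_trans c1 h].
  - move/set_mem: xB => /uB h; rewrite mulr1 mulr0 add0r /b.
    case: ifPn => c1; last exact: powR_ge0.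
    rewrite ge0_ler_powR ?nnegrE ?(ltW p0)//.
    rewrite (ger0_norm c1) distrC; apply: le_trans (ler_norm _); lra.
  - by rewrite !mulr0 addr0 powR_ge0.
have mind (C : set M) (k : R) : measurable (C : set (borel M)) ->
    measurable_fun (boundary X : set (borel M)) 
      (EFin \o (fun x : borel M => (k * \1_C x)%R)).
  by move=> mC; apply/measurable_EFinP; apply: measurable_funM => //;
    apply: measurable_indic.
have iint (C : set M) (k : R) : (0 <= k)%R -> C `<=` boundary X ->
    measurable (C : set (borel M)) ->
    \int[surf]_(x in boundary X) (k * \1_C x)%:E = k%:E * surf C.
  move=> k0 CX mC; under eq_integral do rewrite EFinM.
  have i0 (x : borel M) : boundary X x -> 0 <= (\1_C x : R)%:E.
    by move=> _; rewrite lee_fin indicE.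
  rewrite (ge0_integralZl_nonmeasurable _ k0 i0); congr (_ * _).
  by have := integral_indic surf mbX mC; rewrite setIidl.
apply: (@le_trans _ _ (\int[surf]_(x in boundary X)
    ((a * \1_A x)%:E + (b * \1_B x)%:E))); last first.
  apply: ge0_le_integral_nonmeasurable => // x _.
  by rewrite adde_ge0// lee_fin mulr_ge0// indicE.
rewrite ge0_integralD//; last 4 first.
- by move=> x _; rewrite lee_fin mulr_ge0// indicE.
- exact: mind.
- by move=> x _; rewrite lee_fin mulr_ge0// indicE.
- exact: mind.
rewrite !iint//; apply: (@le_trans _ _ (a%:E * m%:E + b%:E * m%:E)).
  by rewrite -!EFinM -EFinD lee_fin -mulrDl ler_wpM2r// ltW.
by rewrite leeD// lee_wpmul2l.
Qed.

Lemma eigenvalue_le_energy A B u (m : R) : compact A -> A `<=` boundary X ->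
  compact B -> B `<=` boundary X -> smooth_function X u ->
  (forall x, A x -> 1 <= u x)%R -> (forall x, B x -> u x <= 0)%R ->
  (0 < m)%R -> m%:E <= surf A -> m%:E <= surf B ->
  steklov_eigenvalue g vol surf p * m%:E <=
  (2 `^ (p - 1))%:E * energy g vol p u.
Proof.
move=> cA AX cB BX su uA uB m0 mA mB.
have cu := smooth_function_continuous su.
have [c Hc] := signed_power_mean_exists cM measurable_boundary surf_fin p1 cu.
have b_ge := powR_integral_ge c cA AX cB BX cu uA uB m0 mA mB.
have bfin : \int[surf]_(x in boundary X) (`|u x - c| `^ p)%:E \is a fin_num.
  apply: integrable_fin_num; first exact: measurable_boundary.
  exact: boundary_powR_integrable.
pose r := fine (\int[surf]_(x in boundary X) (`|u x - c| `^ p)%:E).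
have rE : \int[surf]_(x in boundary X) (`|u x - c| `^ p)%:E = r%:E by rewrite fineK.
rewrite rE lee_fin in b_ge.
have t0 : (0 < 2 `^ (1 - p) :> R)%R by rewrite powR_gt0.
have r0 : (0 < r)%R by apply: lt_le_trans b_ge; rewrite mulr_gt0.
have sE : steklov_eigenvalue g vol surf p <= energy g vol p u * (r^-1)%:E.
  have wE : (fun x => u x - c)%R = (fun x => 1 * u x + - c)%R.
    by apply/funext => x; rewrite mul1r.
  have : steklov_eigenvalue g vol surf p <=
      steklov_quotient g vol surf p (fun x => u x - c)%R.
    apply: ereal_inf_lbound; exists (fun x => u x - c)%R => //; split=> //.
      by rewrite wE; exact: smooth_function_affine.
    have [x Ax] : A !=set0.
      apply/set0P/negP => /eqP A0; move: mA; rewrite A0 measure0 lee_fin.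
      by rewrite leNgt m0.
    have [y By] : B !=set0.
      apply/set0P/negP => /eqP B0; move: mB; rewrite B0 measure0 lee_fin.
      by rewrite leNgt m0.
    (* If [u - c] vanished identically, then [c] would be both at least 1 and at most 0. *)
    apply: contrapT => H; have uc z : u z = c.
      apply/eqP; rewrite -subr_eq0; apply: contrapT => h.
      by apply: H; exists z; apply/negP.
    have := uA x Ax; have := uB y By; rewrite !uc => h1 h2; lra.
  by rewrite (steklov_quotientE r0 rE) wE energy_affine ?normr1.
apply: (@le_trans _ _ (energy g vol p u * (r^-1)%:E * m%:E)).
  by rewrite lee_wpmul2r// lee_fin ltW.
rewrite -muleA -EFinM muleC lee_wpmul2r ?energy_ge0// lee_fin.
rewrite mulrC ler_pdivrMr// -(@ler_pM2l _ (2 `^ (1 - p))%R)//.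
rewrite mulrA -powRD ?pnatr_eq0 ?implybT//.
have -> : (1 - p + (p - 1) = 0)%R by ring.
by rewrite powRr0 mul1r.
Qed.

Lemma eigenvalue_le_isocapacitary :
  steklov_eigenvalue g vol surf p <=
  (2 `^ (p - 1))%:E * steklov_isocapacitary_constant g vol surf p.
Proof.
have t0 : (0 < 2 `^ (p - 1) :> R)%R by rewrite powR_gt0.
rewrite muleC -lee_pdivrMr//; apply: le_ereal_inf_tmp => _ [[A B] /= HAB <-] /=.
move: HAB => [[cA AX] [cB BX]]; have bA := compact_borel cA; have bB := compact_borel cB.
rewrite !areaE// => min0.
set m := mine (surf A) (surf B) in min0 *.
have mA : m <= surf A by rewrite ge_min lexx.
have mB : m <= surf B by rewrite ge_min lexx orbT.
have mfin : m \is a fin_num.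
  rewrite ge0_fin_numE ?(ltW min0)//; apply: le_lt_trans mA _.
  exact: finite_measure_le.
clearbody m; case: m mfin min0 mA mB => // m _; rewrite lte_fin => m0 mA mB.
rewrite inver gt_eqF// lee_pdivlMr//.
rewrite /capacity; case: ifPn => [_|_]; first exact: leey.
(* Positive area excludes the empty sets, whose capacity is 0 by convention. *)
have nonempty (C : set M) : m%:E <= surf C -> C != set0.
  apply: contraTneq => ->; by rewrite measure0 lee_fin -ltNge.
rewrite (negbTE (nonempty _ mA)) (negbTE (nonempty _ mB)) /=.
apply: le_ereal_inf_tmp => _ [u [su uA uB] <-].
rewrite muleAC lee_pdivrMr// muleC.
rewrite [leRHS]muleC muleC; exact: eigenvalue_le_energy cA AX cB BX su uA uB m0 mA mB.
Qed.

End upper_bound.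

(** * The lower bound *)

Section geometric_levels.
Context {R : realType}.
Implicit Types (a p x s v T : R).

(** A discrete layer-cake inequality: the increments whose lower level is at most [v], together with
    the last term, telescope to the power of a level that is at least [v]. *)
Lemma layer_powR (t : nat -> R) p v (N : nat) : 0 <= p ->
  (forall k, 0 < t k) -> (forall k, t k.+1 <= t k) -> 0 <= v -> v <= t 0%N ->
  v `^ p <= \sum_(k < N) (t k `^ p - t k.+1 `^ p) * (t k.+1 <= v)%R%:R + t N `^ p.
Proof.
move=> p0 t0 td v0 vt; have pw a b : 0 <= a -> a <= b -> a `^ p <= b `^ p.
  by move=> a0 ab; rewrite ge0_ler_powR ?nnegrE// (le_trans a0).
elim: N => [|N IH]; first by rewrite big_ord0 add0r pw.
rewrite big_ord_recr /=; have [tv|vt'] := leP (t N.+1) v.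
  by rewrite mulr1 -addrA subrK.
rewrite mulr0 addr0; apply: (@le_trans _ _ (t N.+1 `^ p)).
  by rewrite pw// ltW.
rewrite lerDr; apply: sumr_ge0 => k _.
by rewrite mulr_ge0// subr_ge0 pw// ltW.
Qed.

Definition level T x (k : nat) : R := T * expR (- (x * k%:R)).

Lemma level0 T x : level T x 0 = T.
Proof. by rewrite /level mulr0 oppr0 expR0 mulr1. Qed.

Lemma level_gt0 T x k : 0 < T -> 0 < level T x k.
Proof. by move=> T0; rewrite mulr_gt0// expR_gt0. Qed.

Lemma levelS T x k : level T x k = expR x * level T x k.+1.
Proof.
rewrite /level mulrCA -expRD; congr (_ * expR _).
by rewrite -natr1 mulrDr mulr1; ring.
Qed.

Lemma levelS_le T x k : 0 < T -> 0 <= x -> level T x k.+1 <= level T x k.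
Proof.
move=> T0 x0; rewrite [leRHS]levelS ler_peMl//; first exact/ltW/level_gt0.
by have := expR_ge1Dx x; lra.
Qed.

Lemma level_powRS T x p k : 0 < T ->
  level T x k `^ p = expR (p * x) * level T x k.+1 `^ p.
Proof.
move=> T0; rewrite levelS powRM ?expR_ge0 ?ltW ?level_gt0//.
by rewrite -expRM [x * p]mulrC.
Qed.

Lemma level_cvg0 T x (e : R) : 0 < T -> 0 < x -> 0 < e ->
  exists N, level T x N <= e.
Proof.
move=> T0 x0 e0; exists (Num.bound (T / e / x)).
have q0 : 0 <= T / e / x by rewrite !divr_ge0// ltW.
set N := Num.bound _; have := archi_boundP q0; rewrite -/N ltr_pdivrMr// => TN.
rewrite /level expRN ler_pdivrMr ?expR_gt0// mulrC -ler_pdivrMr//.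
by have := expR_ge1Dx (x * N%:R); lra.
Qed.

(** While the levels exceed [s] the terms grow by the factor [expR (a * x)] and stay below 1; read
    backwards from the last one they are dominated by a geometric series. *)
Lemma geometric_level_sum T x a s (N : nat) : 0 < T -> 0 < x -> 0 < a -> 0 < s ->
  (1 - expR (- (a * x))) *
    \sum_(k < N) (if s < level T x k.+1 then (s / level T x k.+1) `^ a else 0) <= 1.
Proof.
(* The induction needs a sharper bound than 1: the last term itself, as long as the levels exceed
   [s]. *)
move=> T0 x0 a0 s0; pose Q k := if s < level T x k then (s / level T x k) `^ a else 1.
have Q1 k : Q k <= 1.
  rewrite /Q; case: ifPn => // slk; have l0 := level_gt0 x k T0.
  rewrite -(@powRr0 _ (s / level T x k)) ger_powR ?(ltW a0)//.
  by rewrite divr_gt0// ler_pdivrMr// mul1r ltW.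
suff H : (1 - expR (- (a * x))) *
    \sum_(k < N) (if s < level T x k.+1 then (s / level T x k.+1) `^ a else 0) <= Q N.
  exact: le_trans H (Q1 N).
elim: N => [|N IH].
  by rewrite big_ord0 mulr0 /Q; case: ifP => // _; exact: powR_ge0.
have l1 := level_gt0 x N.+1 T0.
rewrite big_ord_recr mulrDr [Q N.+1]/Q /=.
have [sl|sl] := ltP s (level T x N.+1); last first.
  by rewrite mulr0 addr0 (le_trans IH).
have sl' : s < level T x N by rewrite (lt_le_trans sl)// levelS_le// ltW.
rewrite /Q sl' in IH.
have E : (s / level T x N) `^ a = expR (- (a * x)) * (s / level T x N.+1) `^ a.
  have -> : s / level T x N = expR (- x) * (s / level T x N.+1).
    by rewrite levelS expRN; field; rewrite !gt_eqF ?expR_gt0.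
  rewrite powRM ?expR_ge0 ?divr_ge0 ?(ltW s0) ?(ltW l1)//.
  by rewrite -expRM mulNr [x * a]mulrC.
have step (c w y : R) : (1 - c) * y <= c * w ->
    (1 - c) * y + (1 - c) * w <= w by move=> h; lra.
by apply: step; rewrite -E.
Qed.

(** With [a = p / (p - 1)] one has [(a - 1) * p = a], so the [p]-th powers of the slopes are
    dominated by the terms of [geometric_level_sum]. The resulting bound does not depend on [N]. *)
Lemma cutoff_level_sum (K : R) p T x s (F' : R -> R) (N : nat) :
  1 < p -> 0 < T -> 0 < x -> 0 <= K ->
  (forall r, `|F' r| <= if 0 < r < 1 then K * r `^ (p / (p - 1) - 1) else 0) ->
  \sum_(k < N) (expR (p * x) - 1) * `|F' (s / level T x k.+1)| `^ p <=
  K `^ p * ((expR (p * x) - 1) / (1 - expR (- (p / (p - 1) * x)))) * (0 < s)%R%:R.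
Proof.
move=> p1 T0 x0 K0 HF'; have p0 : 0 < p by exact: lt_trans p1.
have p10 : 0 < p - 1 by rewrite subr_gt0.
set a := p / (p - 1); have a0 : 0 < a by rewrite divr_gt0.
have px : 0 <= expR (p * x) - 1.
  by rewrite subr_ge0 -[leLHS]expR0 ler_expR mulr_ge0// ltW.
have ax : 0 < 1 - expR (- (a * x)).
  by rewrite subr_gt0 expR_lt1 oppr_lt0 mulr_gt0.
have [s0|s0] := ltP 0 s; last first.
  rewrite mulr0 big1// => k _; have := HF' (s / level T x k.+1).
  have l0 := level_gt0 x k.+1 T0.
  have -> : 0 < s / level T x k.+1 = false.
    by apply/negbTE; rewrite -leNgt pmulr_lle0 ?invr_gt0.
  by rewrite /= normr_le0 => /eqP ->; rewrite normr0 powR0 ?mulr0// gt_eqF.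
rewrite mulr1 -mulr_sumr.
apply: (@le_trans _ _ ((expR (p * x) - 1) * (K `^ p *
    \sum_(k < N) (if s < level T x k.+1 then (s / level T x k.+1) `^ a else 0)))).
  rewrite ler_wpM2l// mulr_sumr; apply: ler_sum => k _.
  have l0 := level_gt0 x k.+1 T0; have r0 : 0 < s / level T x k.+1 by rewrite divr_gt0.
  have := HF' (s / level T x k.+1); rewrite r0 /= ltr_pdivrMr// mul1r.
  case: ifPn => _; last first.
    by rewrite normr_le0 => /eqP ->; rewrite normr0 powR0 ?mulr0// gt_eqF.
  move=> h; apply: (@le_trans _ _ ((K * (s / level T x k.+1) `^ (a - 1)) `^ p)).
    by rewrite ge0_ler_powR ?nnegrE ?(ltW p0) ?mulr_ge0 ?powR_ge0.
  rewrite powRM ?powR_ge0// -powRrM.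
  have -> // : (a - 1) * p = a by rewrite /a; field; rewrite gt_eqF.
have G := geometric_level_sum N T0 x0 a0 s0.
rewrite mulrCA ler_wpM2l ?powR_ge0//; apply: ler_wpM2l => //.
by rewrite -div1r ler_pdivlMr// mulrC.
Qed.

(* As [e] and [x] tend to 0 the left-hand side tends to [1 / 2]: the factor 2 in
   the constant of the theorem is what leaves room for these parameters. *)
Lemma hardy_constant p : 1 < p -> exists e x : R,
  [/\ 0 < e, 0 < x &
   (p - 1) `^ (p - 1) / (2 * p `^ p) *
   ((expR (2 * e) * (p / (p - 1))) `^ p *
     ((expR (p * x) - 1) / (1 - expR (- (p / (p - 1) * x))))) <= 3 / 4].
Proof.
move=> p1; have p0 : 0 < p by exact: lt_trans p1.
have p10 : 0 < p - 1 by rewrite subr_gt0.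
set a := p / (p - 1); have a0 : 0 < a by rewrite divr_gt0.
have h32 : (1 : R) < 3 / 2 by rewrite ltr_pdivlMr//; lra.
(* The exponential errors multiply to [expR ((3 * p + a) * e)], which this choice makes equal to
   [3 / 2]. *)
pose e := ln (3 / 2 : R) / (3 * p + a).
have d0 : 0 < 3 * p + a by rewrite addr_gt0// mulr_gt0.
have e0 : 0 < e by rewrite divr_gt0// ln_gt0.
exists e, e; split=> //.
have q1 : expR (p * e) - 1 <= p * e * expR (p * e).
  have := expR_ge1Dx (- (p * e)); rewrite expRN => h.
  have E0 : 0 < expR (p * e) by exact: expR_gt0.
  have : expR (p * e) * (1 - p * e) <= expR (p * e) * (expR (p * e))^-1.
    by rewrite ler_pM2l.
  by rewrite divff ?gt_eqF//; lra.
have q2 : a * e * expR (- (a * e)) <= 1 - expR (- (a * e)).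
  have := expR_ge1Dx (a * e) => h.
  have E0 : 0 < expR (- (a * e)) by exact: expR_gt0.
  have : expR (- (a * e)) * (1 + a * e) <= expR (- (a * e)) * expR (a * e).
    by rewrite ler_pM2l.
  by rewrite -expRD addNr expR0; lra.
have ae0 : 0 < a * e * expR (- (a * e)) by rewrite mulr_gt0 ?expR_gt0 // mulr_gt0.
(* To first order the quotient is [p / a = p - 1]; [q1] and [q2] bound the deviation by an
   exponential factor. *)
have Q : (expR (p * e) - 1) / (1 - expR (- (a * e))) <= (p - 1) * expR ((p + a) * e).
  rewrite ler_pdivrMr; last exact: lt_le_trans q2.
  apply: le_trans q1 _.
  apply: (@le_trans _ _
    ((p - 1) * expR ((p + a) * e) * (a * e * expR (- (a * e))))); last first.
    by rewrite ler_wpM2l// mulr_ge0 ?expR_ge0// ltW.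
  have -> : expR ((p + a) * e) = expR (p * e) * expR (a * e) by rewrite mulrDl expRD.
  have pE : p = (p - 1) * a by rewrite /a; field; rewrite gt_eqF.
  have U0 : expR (a * e) != 0 by rewrite gt_eqF ?expR_gt0.
  rewrite expRN {1}pE le_eqVlt; apply/orP; left; apply/eqP; field.
  exact: U0.
have pa : (expR (2 * e) * a) `^ p = expR (2 * p * e) * a `^ p.
  rewrite powRM ?expR_ge0 ?(ltW a0)// -expRM; congr (expR _ * _); ring.
(* This cancels the constant of the theorem except for its factor [1 / 2]. *)
have aE : a `^ p * (p - 1) `^ (p - 1) * (p - 1) = p `^ p.
  rewrite -mulrA [_ `^ (p - 1) * _]mulrC mulr_powRB1 ?(ltW p10)// -powRM ?ltW//.
  by rewrite /a divfK// gt_eqF.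
have pp0 : 0 < p `^ p by rewrite powR_gt0.
apply: (@le_trans _ _ ((p - 1) `^ (p - 1) / (2 * p `^ p) *
   ((expR (2 * p * e) * a `^ p) * ((p - 1) * expR ((p + a) * e))))).
  rewrite ler_wpM2l//; first by rewrite divr_ge0 ?powR_ge0// mulr_ge0 ?powR_ge0.
  by rewrite pa ler_wpM2l// mulr_ge0 ?expR_ge0 ?powR_ge0.
have -> : (p - 1) `^ (p - 1) / (2 * p `^ p) *
   ((expR (2 * p * e) * a `^ p) * ((p - 1) * expR ((p + a) * e))) =
   (a `^ p * (p - 1) `^ (p - 1) * (p - 1)) / p `^ p / 2 *
   (expR (2 * p * e) * expR ((p + a) * e)).
  by field; rewrite gt_eqF.
rewrite aE divff ?gt_eqF// -expRD.
have -> : 2 * p * e + (p + a) * e = ln (3 / 2).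
  by rewrite /e; field; rewrite gt_eqF.
rewrite lnK ?posrE ?(lt_trans _ h32)//; lra.
Qed.

End geometric_levels.

(** * Medians of a continuous function *)

Section median.
Context {R : realType} {M : ptopologicalType}.
Variables (S : {measure set (borel M) -> \bar R}) (D : set M).
Hypotheses (cM : compact [set: M]) (mD : measurable (D : set (borel M))).
Hypothesis S_fin : (S [set: M] < +oo)%E.
Implicit Types (f u : M -> R).

Definition superlevel f (s : R) : set M := D `&` [set x | s <= f x].
Definition strict_superlevel f (s : R) : set M := D `&` [set x | s < f x].

Lemma measurable_superlevel f (s : R) : continuous f ->
  measurable (superlevel f s : set (borel M)).
Proof.
move=> cf; apply: measurableI => //; apply: closed_borel.
by apply: (@closed_comp _ _ f [set y | s <= y]) => // x _; exact: cf.
Qed.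

Lemma measurable_strict_superlevel f (s : R) : continuous f ->
  measurable (strict_superlevel f s : set (borel M)).
Proof.
move=> cf; apply: measurableI => //; apply: open_borel.
by apply: (@open_comp _ _ f [set y | s < y]) => // x _; exact: cf.
Qed.

(** Continuity from below: the strict superlevel set is the increasing union of the closed ones at
    [s + k.+1%:R^-1]. *)
Lemma measure_strict_superlevel_le f (s : R) (h : \bar R) : continuous f ->
  (forall e : R, 0 < e -> (S (superlevel f (s + e)) <= h)%E) ->
  (S (strict_superlevel f s) <= h)%E.
Proof.
move=> cf H; pose A (k : nat) : set (borel M) := superlevel f (s + k.+1%:R^-1).
have mA k : measurable (A k) by exact: measurable_superlevel.
have AE : strict_superlevel f s = \bigcup_k A k.
  apply/seteqP; split=> [x [Dx /= sx]|x [k _ [Dx /= sx]]].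
    have d0 : 0 < f x - s by rewrite subr_gt0.
    exists (Num.bound (f x - s)^-1) => //; split=> //=.
    rewrite -lerBrDl -[leRHS]invrK lef_pV2 ?posrE ?invr_gt0//.
    have i0 : 0 <= (f x - s)^-1 by rewrite invr_ge0 ltW.
    by apply/ltW/(lt_le_trans (archi_boundP i0)); rewrite ler_nat.
  by split=> //=; apply: lt_le_trans sx; rewrite ltrDl invr_gt0.
have mU : measurable (\bigcup_k A k) by exact: bigcup_measurable.
rewrite AE; have ndA : nondecreasing_seq A.
  move=> k l kl; apply/subsetPset => x [Dx /= sx]; split=> //=.
  by apply: le_trans sx; rewrite lerD2l lef_pV2 ?posrE// ler_nat.
apply: cvge_le (nondecreasing_cvg_mu mA mU ndA).
by apply: nearW => k; apply: H; rewrite invr_gt0.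
Qed.

Lemma superlevelC u s : D `\` superlevel u s = strict_superlevel (fun x => - u x)%R (- s).
Proof.
apply/seteqP; split=> x.
  by move=> [Dx H]; split=> //=; rewrite ltrN2 ltNge; apply/negP => h; exact: H.
by move=> [Dx /=]; rewrite ltrN2 => h; split=> // -[_ /=]; rewrite leNgt h.
Qed.

(** Take for [c] the infimum of the levels exceeded on at most half of [D]. Each inequality passes
    through [a / 2], and ensures that the superlevel set realizes the minimum in the isocapacitary
    quotient. *)
Lemma median_exists u : continuous u -> exists c : R, forall t : R, 0 < t ->
  (S (superlevel u (c + t)) <= S (superlevel (fun x => - u x)%R (- c)))%E /\
  (S (superlevel (fun x => - u x)%R (- c + t)) <= S (superlevel u c))%E.
Proof.
move=> cu; have cNu : continuous (fun x => - u x)%R.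
  by move=> x; apply: cvgN; exact: cu.
have [K HK] := continuous_bounded cM cu.
have Sfin (A : set (borel M)) : measurable A -> S A \is a fin_num.
  by move=> mA; rewrite ge0_fin_numE//; exact: finite_measure_le.
pose a := fine (S D); have aE : S D = a%:E by rewrite fineK// Sfin.
have a0 : 0 <= a by rewrite fine_ge0.
have SDle (A : set (borel M)) : measurable A -> A `<=` D -> (S A <= a%:E)%E.
  by move=> mA AD; rewrite -aE le_measure// inE.
have SD (A : set (borel M)) : measurable A -> A `<=` D ->
    S (D `\` A) = (a - fine (S A))%:E.
  move=> mA AD; have DAfin := finite_measure_le S_fin mD.
  have := measureD mD mA DAfin; rewrite setIidr// => ->.
  by rewrite EFinB fineK ?Sfin// fineK ?Sfin.
have half (A : set (borel M)) : measurable A -> A `<=` D ->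
    (S (D `\` A) <= (a / 2)%:E)%E -> ((a / 2)%:E <= S A)%E.
  move=> mA AD; rewrite SD// lee_fin => h.
  by rewrite -(fineK (Sfin A mA)) lee_fin; lra.
(* If [D] is null, the set [G] below is the whole line and has no infimum, but then both sides are
   0. *)
have [az|an0] := eqVneq a 0.
  have S0 (A : set (borel M)) : measurable A -> A `<=` D -> S A = 0%E.
    move=> mA AD; apply/eqP; rewrite eq_le measure_ge0 andbT.
    by have := SDle A mA AD; rewrite az.
  exists 0 => t _; rewrite !S0//; try exact: measurable_superlevel;
    by move=> x [].
have {an0}a0 : 0 < a by rewrite lt_neqAle eq_sym an0.
pose G := [set t : R | (S (strict_superlevel u t) <= (a / 2)%:E)%E].
have Gne : G !=set0.
  exists K; rewrite /G /= (_ : strict_superlevel u K = set0) ?measure0.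
    by rewrite lee_fin divr_ge0// ltW.
  apply/seteqP; split=> // x [_ /=]; rewrite ltNge.
  by rewrite (le_trans (ler_norm _) (HK x)).
have Glb : lbound G (- K - 1).
  move=> t Gt; rewrite leNgt; apply/negP => tK; move: Gt; rewrite /G /=.
  rewrite (_ : strict_superlevel u t = D); first by rewrite aE lee_fin; lra.
  apply/seteqP; split=> [x []//|x Dx]; split=> //=.
  by have := HK x; rewrite ler_norml => /andP[h _]; lra.
have Ginf : has_inf G by split=> //; exists (- K - 1).
pose c := inf G; exists c => t t0.
have P1 e : 0 < e -> (S (superlevel u (c + e)) <= (a / 2)%:E)%E.
  move=> e0; have [s Gs sc] := inf_adherent e0 Ginf.
  apply: le_trans Gs; apply: le_measure; rewrite ?inE.
  - exact: measurable_superlevel.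
  - exact: measurable_strict_superlevel.
  - by move=> x [Dx /= h]; split=> //=; exact: lt_le_trans sc h.
have P2 e : 0 < e -> (S (superlevel (fun x => - u x)%R (- c + e)) <= (a / 2)%:E)%E.
  (* If [{u <= c - e}] had more than half the measure, then [c - e] would belong to [G], below its
     infimum. *)
  move=> e0; rewrite leNgt; apply/negP => h.
  have : c <= c - e.
    apply: ge_inf; first by exists (- K - 1).
    rewrite /G /=.
    have -> : strict_superlevel u (c - e) =
        D `\` superlevel (fun x => - u x)%R (- c + e).
      rewrite superlevelC opprD opprK (_ : (fun x => - - u x)%R = u)//.
      by apply/funext => x; rewrite opprK.
    have mL := measurable_superlevel (- c + e) cNu.
    have LD : superlevel (fun x => - u x)%R (- c + e) `<=` D by move=> x [].
    rewrite SD// lee_fin.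
    by move: h; rewrite -(fineK (Sfin _ mL)) lte_fin; lra.
  by lra.
split.
- apply: le_trans (P1 t t0) _; apply: half.
  + exact: measurable_superlevel.
  + by move=> x [].
  rewrite superlevelC (_ : (fun x => - - u x)%R = u) ?opprK.
    exact: measure_strict_superlevel_le.
  by apply/funext => x; rewrite opprK.
- apply: le_trans (P2 t t0) _; apply: half.
  + exact: measurable_superlevel.
  + by move=> x [].
  by rewrite superlevelC; exact: measure_strict_superlevel_le.
Qed.

End median.

Lemma norm_powR_le_parts {R : realType} (p y : R) :
  `|y| `^ p <= Num.max y 0 `^ p + Num.max (- y) 0 `^ p.
Proof.
have [y0|y0] := leP 0 y; first by rewrite ger0_norm// lerDl powR_ge0.
rewrite ltr0_norm// max_l ?lerDr ?powR_ge0// oppr_ge0; exact: ltW.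
Qed.

(** * Capacities of superlevel sets and the lower bound *)

Section lower_bound.
Context {R : realType} {n : nat} {M : ptopologicalType}.
Variables (X : smooth_atlas R n M) (g : riemannian_metric X).
Variables (vol surf : {measure set (borel M) -> \bar R}) (p : R).
Hypotheses (hM : hausdorff_space M) (cM : compact [set: M]).
Hypothesis surf_fin : (surf [set: M] < +oo)%E.
Hypothesis p1 : 1 < p.
Local Open Scope ereal_scope.
Implicit Types (u w : M -> R).

Let p0 : (0 < p)%R. Proof. exact: lt_trans p1. Qed.
Let bX := boundary X.
Let mbX : measurable (bX : set (borel M)) := @measurable_boundary _ _ _ X.
Let Gamma := steklov_isocapacitary_constant g vol surf p.
Let grad w x : R := (gradient_norm g w x `^ p)%R.

Lemma capacity_ge0 A B : 0 <= capacity g vol p A B.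
Proof.
rewrite /capacity; case: ifP => // _; case: ifP => // _.
by apply: le_ereal_inf_tmp => _ [u _ <-]; exact: energy_ge0.
Qed.

Lemma isocapacitary_ge0 : 0 <= Gamma.
Proof.
apply: le_ereal_inf_tmp => _ [[A B] /= [_ _ AB] <-] /=.
by rewrite mule_ge0 ?capacity_ge0// inve_ge0 ltW.
Qed.

Lemma compact_superlevel w (s : R) : continuous w -> compact (superlevel bX w s).
Proof.
move=> cw; apply: (@subclosed_compact _ _ [set: M]) => //.
apply: closedI; first exact: closed_boundary.
by apply: (@closed_comp _ _ w [set y | s <= y]%R) => // x _; exact: cw.
Qed.

Section one_sided.
Variables (K : R) (F F' : R -> R).
Hypothesis K0 : (0 <= K)%R.
Hypothesis HF : smooth_step_spec K (p / (p - 1)) F F'.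
Variable w : M -> R.
Hypothesis sw : smooth_function X w.
Let cw : continuous w := smooth_function_continuous sw.

Let sublevel0 : set M := superlevel bX (fun x => - w x)%R 0.

(** The test function is [F (w / t)]; by the chain rule its gradient carries the factor
    [F' (w / t) / t]. *)
Lemma capacity_superlevel_le (t : R) : (0 < t)%R ->
  capacity g vol p (superlevel bX w t) sublevel0 <=
  (t `^ p)^-1%:E * \int[vol]_(x in [set: M])
    (`|F' (w x / t)| `^ p * grad w x)%:E.
Proof.
move=> t0; have [sF dF F0 F1 _] := HF.
(* This settles the convention that the capacity is 0 when one of the sets is empty. *)
have RHS0 : 0 <= (t `^ p)^-1%:E * \int[vol]_(x in [set: M])
    (`|F' (w x / t)| `^ p * grad w x)%:E.
  rewrite mule_ge0 ?lee_fin ?invr_ge0 ?powR_ge0// integral_ge0// => x _.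
  by rewrite lee_fin mulr_ge0 ?powR_ge0.
rewrite /capacity ifF; last first.
  apply/negbTE; rewrite negbK; apply/eqP/seteqP; split=> // x [[_ /= h1] [_ /= h2]].
  by rewrite oppr_ge0 in h2; move: (lt_le_trans t0 h1); rewrite ltNge h2.
case: ifP => // _; pose a (x : M) := (t^-1 * w x + 0)%R.
have aE x : a x = (w x / t)%R by rewrite /a addr0 mulrC.
apply: (@le_trans _ _ (energy g vol p (F \o a))).
  apply: ereal_inf_lbound; exists (F \o a) => //; split.
  - apply: smooth_function_comp; last exact: smooth_function_affine.
    by move=> U f oU sf; exact: sF.
  - by move=> x [_ /= h]; rewrite aE F1// ler_pdivlMr// mul1r.
  - move=> x [_ /=]; rewrite oppr_ge0 => h.
    by rewrite aE F0// pmulr_lle0// invr_gt0.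
rewrite -ge0_integralZl_nonmeasurable ?invr_ge0 ?powR_ge0//; last first.
  by move=> x _; rewrite lee_fin mulr_ge0 ?powR_ge0.
rewrite le_eqVlt; apply/orP; left; apply/eqP; apply: eq_integral => x _.
rewrite (gradient_norm_comp g _ (dF (a x))); last exact: smooth_function_affine.
rewrite gradient_norm_affine// aE -EFinM; congr (_%:E).
rewrite powRM ?mulr_ge0 ?gradient_norm_ge0// powRM ?gradient_norm_ge0//.
have tE : (t^-1 `^ p = (t `^ p)^-1)%R.
  by rewrite -[t^-1%R]powR_inv1 ?(ltW t0)// powRAC powR_inv1 ?powR_ge0.
have tn : (`|t^-1| = t^-1)%R by rewrite gtr0_norm ?invr_gt0.
by rewrite tn tE /grad mulrCA.
Qed.

Hypothesis small : forall t : R, (0 < t)%R ->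
  surf (superlevel bX w t) <= surf sublevel0.

Lemma isocapacitary_superlevel_le (t : R) : (0 < t)%R ->
  Gamma * ((t `^ p)%:E * surf (superlevel bX w t)) <=
  \int[vol]_(x in [set: M]) (`|F' (w x / t)| `^ p * grad w x)%:E.
Proof.
move=> t0; set I := integral _ _ _.
have mA : measurable (superlevel bX w t : set (borel M)).
  exact: measurable_superlevel.
have cNw : continuous (fun x => - w x)%R by move=> x; apply: cvgN; exact: cw.
have mB : measurable (sublevel0 : set (borel M)) by exact: measurable_superlevel.
have I0 : 0 <= I.
  by apply: integral_ge0 => x _; rewrite lee_fin mulr_ge0 ?powR_ge0.
have tp0 : (0 < t `^ p)%R by rewrite powR_gt0.
have Sfin : surf (superlevel bX w t) \is a fin_num.
  by rewrite ge0_fin_numE//; exact: finite_measure_le.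
have sE : surf (superlevel bX w t) = (fine (surf (superlevel bX w t)))%:E.
  by rewrite fineK.
have s0 : (0 <= fine (surf (superlevel bX w t)))%R by rewrite fine_ge0.
(* A null superlevel set is not admissible for [Gamma]; the left-hand side is then 0, even if
   [Gamma] is infinite. *)
move: s0; rewrite le_eqVlt => /predU1P[sz|s0].
  by rewrite sE -sz !mule0.
rewrite sE; set s := fine _ in sE s0 *.
have min_s : mine (area surf (superlevel bX w t)) (area surf sublevel0) = s%:E.
  by rewrite !areaE// sE min_l// -sE small.
have : Gamma <= capacity g vol p (superlevel bX w t) sublevel0 * s^-1%:E.
  apply: ereal_inf_lbound; exists (superlevel bX w t, sublevel0) => /=.
    rewrite min_s lte_fin; split=> //; (split; first exact: compact_superlevel);
      by move=> x [].
  by rewrite min_s inver gt_eqF.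
rewrite lee_pdivlMr// => H.
rewrite muleCA muleC -lee_pdivlMr// [leRHS]muleC.
exact: le_trans H (capacity_superlevel_le t0).
Qed.

Variables (T x : R) (N : nat).
Hypotheses (T0 : (0 < T)%R) (x0 : (0 < x)%R).
Let t := level T x.
Let c (k : nat) : R := (t k `^ p - t k.+1 `^ p)%R.
Let layers : \bar R := \sum_(k < N) (c k)%:E * surf (superlevel bX w (t k.+1)).

Let t0 k : (0 < t k)%R. Proof. exact: level_gt0. Qed.

Let c0 k : (0 <= c k)%R.
Proof.
rewrite subr_ge0 ge0_ler_powR ?nnegrE ?(ltW p0) ?(ltW (t0 _))//.
by apply: levelS_le => //; exact: ltW.
Qed.

Lemma layers_ge0 : 0 <= layers.
Proof. by apply: sume_ge0 => k _; rewrite mule_ge0 ?lee_fin. Qed.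

Lemma positive_part_le_layers : (forall q, w q <= T)%R ->
  \int[surf]_(q in bX) (Num.max (w q) 0 `^ p)%:E <=
  layers + (t N `^ p)%:E * surf bX.
Proof.
move=> wT; pose h k : M -> \bar R :=
  fun q => (c k)%:E * (\1_(superlevel bX w (t k.+1)) q)%:E.
have mS k : measurable (superlevel bX w (t k.+1) : set (borel M)).
  exact: measurable_superlevel.
have h0 k q : 0 <= h k q by rewrite mule_ge0 ?lee_fin// indicE.
have mh k : measurable_fun (bX : set (borel M)) (h k).
  by apply: measurable_funeM; apply/measurable_EFinP; exact: measurable_indic.
have mcst : measurable_fun (bX : set (borel M)) (cst (t N `^ p)%:E).
  exact: measurable_cst.
apply: (@le_trans _ _ (\int[surf]_(q in bX) (\sum_(k < N) h k q + (t N `^ p)%:E))).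
  apply: ge0_le_integral_nonmeasurable => q bq; first by rewrite lee_fin powR_ge0.
  have v0 : (0 <= Num.max (w q) 0)%R by rewrite le_max lexx orbT.
  have vT : (Num.max (w q) 0 <= t 0%N)%R.
    by rewrite /t level0 ge_max wT ltW.
  have td k : (t k.+1 <= t k)%R by apply: levelS_le => //; exact: ltW.
  have := layer_powR N (ltW p0) t0 td v0 vT; rewrite -lee_fin => /le_trans; apply.
  rewrite EFinD leeD2r// -sumEFin; apply: lee_sum => k _.
  rewrite /h -EFinM lee_fin ler_wpM2l ?c0// indicE.
  rewrite ler_nat; have [|//] := boolP (_ <= _)%R.
  rewrite le_max [(t k.+1 <= 0)%R]leNgt t0 orbF => tw.
  by rewrite mem_set.
have sm : measurable_fun (bX : set (borel M)) (fun q => \sum_(k < N) h k q).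
  exact: emeasurable_sum.
rewrite ge0_integralD//; last 2 first.
- by move=> q _; rewrite sume_ge0.
- by move=> q _; rewrite lee_fin powR_ge0.
rewrite integral_cst// leeD2r// ge0_integral_sum//.
apply: lee_sum => k _; rewrite ge0_integralZl_nonmeasurable//.
have SX : superlevel bX w (t k.+1) `<=` bX by move=> q [].
by rewrite (integral_indic surf mbX (mS k)) setIidl.
Qed.

(** Each increment [c k] is a fixed multiple of the [p]-th power of [t k.+1], so
    [isocapacitary_superlevel_le] applies to each layer. The sum enters the integral by
    superadditivity and is bounded pointwise. The factor [0 < w q] lets the two signs share the
    energy. *)
Lemma layers_le_energy :
  Gamma * layers <=
  (K `^ p * ((expR (p * x) - 1) / (1 - expR (- (p / (p - 1) * x)))))%:E *
  \int[vol]_(q in [set: M]) ((0 < w q)%R%:R * grad w q)%:E.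
Proof.
have [_ _ _ _ HF'] := HF.
have px : (0 <= expR (p * x) - 1)%R.
  by rewrite subr_ge0 -[leLHS]expR0 ler_expR mulr_ge0// ltW.
have gr0 q : (0 <= grad w q)%R by exact: powR_ge0.
have cE k : c k = ((expR (p * x) - 1) * t k.+1 `^ p)%R.
  by rewrite /c /t level_powRS// mulrBl mul1r.
rewrite /layers ge0_sume_distrr; last first.
  by move=> k _; rewrite mule_ge0 ?lee_fin.
pose f (k : 'I_N) q : \bar R :=
  ((expR (p * x) - 1) * (`|F' (w q / t k.+1)| `^ p * grad w q))%:E.
have f0 k q : 0 <= f k q.
  by rewrite lee_fin !mulr_ge0 ?powR_ge0.
apply: (@le_trans _ _ (\sum_(k < N) \int[vol]_(q in [set: M]) f k q)).
  apply: lee_sum => k _; rewrite cE EFinM -muleA muleCA.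
  apply: (@le_trans _ _ ((expR (p * x) - 1)%:E *
     \int[vol]_(q in [set: M]) (`|F' (w q / t k.+1)| `^ p * grad w q)%:E)).
    by rewrite lee_wpmul2l ?lee_fin// isocapacitary_superlevel_le.
  by apply: ge0_integralZl_super => // q _; rewrite lee_fin mulr_ge0 ?powR_ge0.
apply: le_trans (ge0_integral_sum_super _ _) _; first by move=> k q _.
rewrite -ge0_integralZl_nonmeasurable; last 2 first.
- rewrite mulr_ge0 ?powR_ge0// divr_ge0// subr_ge0 -[leRHS]expR0 ler_expR.
  by rewrite oppr_le0 mulr_ge0 ?divr_ge0 ?ltW// subr_gt0.
- by move=> q _; rewrite lee_fin mulr_ge0.
apply: ge0_le_integral_nonmeasurable => q _; first by rewrite sume_ge0.
have := cutoff_level_sum (w q) N p1 T0 x0 K0 HF'; set K2 := (_ * (_ / _))%R => H.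
rewrite sumEFin -EFinM lee_fin mulrA.
under eq_bigr do rewrite mulrA.
by rewrite -mulr_suml ler_wpM2r.
Qed.

End one_sided.

(** Integrate [tangent_powR] with [a = u x]: the term linear in [c] drops out by the constraint. *)
Lemma boundary_powR_le u (c : R) : continuous u ->
  \int[surf]_(x in bX) (`|u x| `^ (p - 2) * u x)%:E = 0 ->
  \int[surf]_(x in bX) (`|u x| `^ p)%:E <=
  \int[surf]_(x in bX) (`|u x - c| `^ p)%:E.
Proof.
move=> cu u0.
have int_pow d : surf.-integrable (bX : set (borel M))
    (EFin \o (fun x => `|u x - d| `^ p)%R).
  exact: boundary_powR_integrable.
have ip : surf.-integrable (bX : set (borel M)) (EFin \o (fun x => `|u x| `^ p)%R).
  have := int_pow 0%R; congr (integrable _ _ _).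
  by apply/funext => x /=; rewrite subr0.
have isp : surf.-integrable (bX : set (borel M))
    (EFin \o (fun x => `|u x| `^ (p - 2) * u x)%R).
  apply: continuous_integrable => //.
  have := @continuous_signed_power_comp _ _ _ p1 u 0%R cu.
  rewrite (_ : (fun x => _) = (fun x => `|u x| `^ (p - 2) * u x)%R)//.
  by apply/funext => x; rewrite subr0.
have isc : surf.-integrable (bX : set (borel M))
    (fun x => (p * c)%:E * (`|u x| `^ (p - 2) * u x)%:E).
  exact: integrableZl.
have -> : \int[surf]_(x in bX) (`|u x| `^ p)%:E =
   \int[surf]_(x in bX) ((`|u x| `^ p)%:E - (p * c)%:E * (`|u x| `^ (p - 2) * u x)%:E).
  by rewrite (integralB mbX ip isc) integralZl// u0 mule0 sube0.
apply: (le_integral mbX (integrableB mbX ip isc) (int_pow c)).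
by move=> x _; rewrite -EFinM -EFinB lee_fin tangent_powR.
Qed.

Lemma isocapacitary_le_quotient u : smooth_function X u ->
  \int[surf]_(x in bX) (`|u x| `^ (p - 2) * u x)%:E = 0 ->
  ((p - 1) `^ (p - 1) / (2 * p `^ p))%:E * Gamma <=
  steklov_quotient g vol surf p u.
Proof.
move=> su u0; have cu := smooth_function_continuous su.
have pow_fin d : \int[surf]_(x in bX) (`|u x - d| `^ p)%:E \is a fin_num.
  by apply: integrable_fin_num => //; exact: boundary_powR_integrable.
have b_fin : \int[surf]_(x in bX) (`|u x| `^ p)%:E \is a fin_num.
  have := pow_fin 0%R.
  rewrite (eq_integral (fun x : borel M => (`|u x| `^ p)%:E))// => x _.
  by rewrite subr0.
have b_ge0 : 0 <= \int[surf]_(x in bX) (`|u x| `^ p)%:E.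
  by apply: integral_ge0 => x _; rewrite lee_fin powR_ge0.
pose r := fine (\int[surf]_(x in bX) (`|u x| `^ p)%:E).
have rE : \int[surf]_(x in bX) (`|u x| `^ p)%:E = r%:E by rewrite fineK.
have : (0 <= r)%R by exact: fine_ge0.
(* If the denominator is 0, the quotient is infinite by convention. *)
rewrite le_eqVlt => /predU1P[rz|r0].
  by rewrite /steklov_quotient rE -rz eqxx leey.
rewrite (steklov_quotientE _ _ r0 rE) lee_pdivlMr//.
have [c Hc] := median_exists cM mbX surf_fin cu.
pose I := fine (\int[surf]_(x in bX) (`|u x - c| `^ p)%:E).
have IE : \int[surf]_(x in bX) (`|u x - c| `^ p)%:E = I%:E.
  by apply/esym/fineK; exact: pow_fin.
have rI : (r <= I)%R.
  by have := boundary_powR_le c cu u0; rewrite rE IE lee_fin.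
have I0 : (0 < I)%R by exact: lt_le_trans rI.
have [e [x [e0 x0 hardy]]] := hardy_constant p1.
have a1 : (1 < p / (p - 1))%R.
  by rewrite ltr_pdivlMr ?subr_gt0// mul1r ltrBlDr ltrDl.
have [F [F' HF]] := smooth_stepP e0 a1.
set K := (expR (2 * e) * (p / (p - 1)))%R in hardy HF.
have K0 : (0 <= K)%R by rewrite mulr_ge0 ?expR_ge0// ltW// (lt_trans ltr01 a1).
have [L HL] := continuous_bounded cM cu.
pose T := (`|L| + `|c| + 1)%R.
have T0 : (0 < T)%R by rewrite ltr_wpDl// addr_ge0.
have uT q : (`|u q - c| <= T)%R.
  apply: le_trans (ler_normB _ _) _; have := HL q; have := ler_norm L.
  by rewrite /T; lra.
have Dfin : surf bX \is a fin_num by rewrite ge0_fin_numE// finite_measure_le.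
pose a := fine (surf bX); have aE : surf bX = a%:E by rewrite fineK.
have a0 : (0 <= a)%R by exact: fine_ge0.
(* Bounds the power of the last level, so that the part below it contributes at most [I / 8] for
   each sign; [a + 1] keeps the divisor positive. *)
pose d := (I / (8 * (a + 1)))%R.
have d0 : (0 < d)%R by rewrite divr_gt0// mulr_gt0// ltr_wpDl.
have [N HN] := level_cvg0 T0 x0 (powR_gt0 p^-1 d0).
have tN : (level T x N `^ p * a <= I / 8)%R.
  have t0 := level_gt0 x N T0.
  have : (level T x N `^ p <= d)%R.
    have -> : d = ((d `^ p^-1) `^ p)%R.
      by rewrite -powRrM mulVf ?gt_eqF// powRr1 ?ltW.
    by rewrite ge0_ler_powR ?nnegrE ?powR_ge0// ltW.
  move=> tp; apply: (@le_trans _ _ (d * a)%R); first by rewrite ler_wpM2r.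
  rewrite /d mulrAC ler_pdivrMr ?mulr_gt0 ?ltr_wpDl//.
  have -> : (I / 8 * (8 * (a + 1)) = I * a + I)%R by field.
  by rewrite lerDl ltW.
pose w1 q := (1 * u q + - c)%R; pose w2 q := (-1 * u q + c)%R.
have sw1 : smooth_function X w1 by exact: smooth_function_affine.
have sw2 : smooth_function X w2 by exact: smooth_function_affine.
have w1T q : (w1 q <= T)%R.
  by rewrite /w1 mul1r; apply: le_trans (ler_norm _) _.
have w2T q : (w2 q <= T)%R.
  by rewrite /w2 mulN1r addrC; apply: le_trans (ler_norm _) _; rewrite distrC.
have lvl (f h : M -> R) (s s' : R) : (forall q, (s <= f q) = (s' <= h q))%R ->
    superlevel bX f s = superlevel bX h s'.
  move=> fh; congr (_ `&` _); apply/funext => q /=; by rewrite fh.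
have small1 t : (0 < t)%R -> surf (superlevel bX w1 t) <=
    surf (superlevel bX (fun q => - w1 q)%R 0).
  move=> t0; have [h _] := Hc t t0.
  rewrite (lvl w1 u t (c + t)%R); last by move=> q; rewrite /w1; lra.
  rewrite (lvl (fun q => - w1 q)%R (fun q => - u q)%R 0%R (- c)%R)//.
  by move=> q; rewrite /w1; lra.
have small2 t : (0 < t)%R -> surf (superlevel bX w2 t) <=
    surf (superlevel bX (fun q => - w2 q)%R 0).
  move=> t0; have [_ h] := Hc t t0.
  rewrite (lvl w2 (fun q => - u q)%R t (- c + t)%R); last by move=> q; rewrite /w2; lra.
  rewrite (lvl (fun q => - w2 q)%R u 0%R c)//.
  by move=> q; rewrite /w2; lra.
have L1 := layers_le_energy K0 HF sw1 small1 N T0 x0.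
have L2 := layers_le_energy K0 HF sw2 small2 N T0 x0.
have P1 := positive_part_le_layers sw1 N T0 x0 w1T.
have P2 := positive_part_le_layers sw2 N T0 x0 w2T.
set A1 := \sum_(k < N) _ in L1 P1; set A2 := \sum_(k < N) _ in L2 P2.
set K2 := (K `^ p * _)%R in hardy L1 L2.
have A10 : 0 <= A1 by exact: layers_ge0.
have A20 : 0 <= A2 by exact: layers_ge0.
have mpos w : continuous w -> measurable_fun (bX : set (borel M))
    (EFin \o (fun q : borel M => Num.max (w q) 0 `^ p)%R).
  move=> cw; apply/measurable_EFinP; apply: measurable_funTS.
  apply: (@measurableT_comp _ _ _ _ _ _ (@powR R ^~ p)) => //.
  by apply: measurable_maxr => //; exact: continuous_borel_measurable.
have m1 := mpos w1 (smooth_function_continuous sw1).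
have m2 := mpos w2 (smooth_function_continuous sw2).
have split_le : I%:E <= A1 + (level T x N `^ p)%:E * surf bX +
    (A2 + (level T x N `^ p)%:E * surf bX).
  apply: le_trans (leeD P1 P2); rewrite -IE -ge0_integralD//; last 2 first.
  - by move=> q _; rewrite lee_fin powR_ge0.
  - by move=> q _; rewrite lee_fin powR_ge0.
  apply: ge0_le_integral_nonmeasurable => q _; first by rewrite lee_fin powR_ge0.
  rewrite -EFinD lee_fin.
  have -> : w1 q = (u q - c)%R by rewrite /w1 mul1r.
  have -> : w2 q = (- (u q - c))%R by rewrite /w2 mulN1r opprB addrC.
  exact: norm_powR_le_parts.
(* The two remainders of at most [I / 8] cost a quarter of [I]. *)
have A12 : (3 / 4 * I)%:E <= A1 + A2.
  rewrite aE -EFinM addeACA -EFinD in split_le.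
  rewrite -(@leeD2rE _ (level T x N `^ p * a + level T x N `^ p * a)%:E)//.
  apply: le_trans split_le; rewrite -EFinD lee_fin.
  by move: tN; set tNa := (_ * a)%R; lra.
pose e1 q : \bar R := ((0 < w1 q)%R%:R * grad w1 q)%:E.
pose e2 q : \bar R := ((0 < w2 q)%R%:R * grad w2 q)%:E.
have e10 q : 0 <= e1 q by rewrite lee_fin mulr_ge0 ?powR_ge0.
have e20 q : 0 <= e2 q by rewrite lee_fin mulr_ge0 ?powR_ge0.
(* The regions where [w1] and [w2 = - w1] are positive are disjoint, and both functions have the
   gradient norm of [u]. *)
have E12 : \int[vol]_(q in [set: M]) e1 q + \int[vol]_(q in [set: M]) e2 q <=
    energy g vol p u.
  have S12 := @ge0_integralD_super _ _ _ vol [set: borel M] e1 e2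
    (fun q _ => e10 q) (fun q _ => e20 q).
  apply: (le_trans S12); apply: ge0_le_integral_nonmeasurable => q _.
    exact (adde_ge0 (e10 q) (e20 q)).
  rewrite -EFinD lee_fin /grad !gradient_norm_affine// normrN1 normr1 mul1r.
  have w21 : w2 q = (- w1 q)%R by rewrite /w1 /w2; lra.
  rewrite w21 oppr_gt0 -mulrDl ler_piMl ?powR_ge0//.
  by case: ltgtP => _; rewrite ?addr0 ?add0r.
have K20 : (0 <= K2)%R.
  rewrite mulr_ge0 ?powR_ge0// divr_ge0// subr_ge0.
    by rewrite -[leLHS]expR0 ler_expR mulr_ge0// ltW.
  rewrite -[leRHS]expR0 ler_expR oppr_le0 mulr_ge0 ?ltW//.
  exact: lt_trans ltr01 a1.
have G0 := isocapacitary_ge0.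
have GI : Gamma * (3 / 4 * I)%:E <= K2%:E * energy g vol p u.
  apply: (@le_trans _ _ (Gamma * (A1 + A2))); first by rewrite lee_wpmul2l.
  rewrite ge0_muleDr//; apply: le_trans (leeD L1 L2) _.
  have i1 : 0 <= \int[vol]_(q in [set: M]) e1 q.
    exact (integral_ge0 vol (fun q _ => e10 q)).
  have i2 : 0 <= \int[vol]_(q in [set: M]) e2 q.
    exact (integral_ge0 vol (fun q _ => e20 q)).
  by rewrite -(ge0_muleDr _ i1 i2) lee_wpmul2l// lee_fin.
set C := ((p - 1) `^ (p - 1) / (2 * p `^ p))%R in hardy *.
have C0 : (0 <= C)%R by rewrite divr_ge0 ?mulr_ge0 ?powR_ge0.
(* The factor [4 / 3] undoes the loss in [A12] and is absorbed by [C * K2 <= 3 / 4]. *)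
have C430 : (0 <= 4 / 3 * C)%R by rewrite mulr_ge0// divr_ge0.
apply: (@le_trans _ _ ((4 / 3 * C)%:E * (Gamma * (3 / 4 * I)%:E))).
  rewrite [C%:E * _]muleC -muleA [leRHS]muleCA -!EFinM lee_wpmul2l// lee_fin.
  have -> : (4 / 3 * C * (3 / 4 * I) = C * I)%R by field.
  by rewrite ler_wpM2l.
apply: (@le_trans _ _ ((4 / 3 * C)%:E * (K2%:E * energy g vol p u))).
  by rewrite lee_wpmul2l ?lee_fin.
rewrite muleA -EFinM -[leRHS]mul1e lee_wpmul2r ?energy_ge0// lee_fin -mulrA.
by move: hardy; lra.
Qed.

Lemma isocapacitary_le_eigenvalue :
  ((p - 1) `^ (p - 1) / (2 * p `^ p))%:E * Gamma <=
  steklov_eigenvalue g vol surf p.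
Proof.
apply: le_ereal_inf_tmp => _ [u [su u0 _] <-].
exact: isocapacitary_le_quotient.
Qed.

End lower_bound.

Theorem corollary1p2 (R : realType) (n : nat) (M : ptopologicalType)
  (X : smooth_atlas R n M) (g : riemannian_metric X)
  (vol surf : {measure set (borel M) -> \bar R}) (p : R) :
  hausdorff_space M -> compact [set: M] -> connected [set: M] ->
  boundary X !=set0 ->
  is_volume_measure g vol -> is_boundary_measure g surf ->
  1 < p ->
  (((p - 1) `^ (p - 1) / (2 * p `^ p))%:E
     * steklov_isocapacitary_constant g vol surf p
   <= steklov_eigenvalue g vol surf p)%E
  /\
  (steklov_eigenvalue g vol surf p
   <= (2 `^ (p - 1))%:E * steklov_isocapacitary_constant g vol surf p)%E.
Proof.
move=> hM cM _ _ _ surfE p1.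
have surf_fin := boundary_measure_finite cM surfE.
by split; [exact: isocapacitary_le_eigenvalue|exact: eigenvalue_le_isocapacitary].
Qed.
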